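(* Let $x_1,x_2,\ldots$ be iid observations distributed according to a one-dimensional exponential family with density $p_\theta(x)=\exp(\eta(\theta)T(x)-A(\eta(\theta))-B(x))$ with respect to $\nu$ (satisfying the assumptions listed in the context), and let $\theta$ be distributed according to a prior having a continuous strictly positive density $\pi$ on a convex set $\Theta\subseteq\mathbb{R}$. (i) Let $\theta_0$ be an interior point of $\Theta$; then $$\mathbb{E}_{\theta_0}[q_n^{\theta_0}]\sim\frac{\sqrt{I(\theta_0)}}{2\sqrt{\pi_{\circ}}}\sqrt{n}\quad\text{as }n\to\infty,$$ where $\pi_\circ=3.14159\ldots$ denotes the circle constant. (ii) Let $\theta_1\neq\theta_0$ be in $\Theta$; then $$\mathbb{E}_{\theta_1}[q_n^{\theta_0}]=\frac{\pi(\theta_0)}{\pi(\theta_2)}\,\mathbb{E}_{\theta_2}[q_n^{\theta_2}]\,w^n\sim\frac{\pi(\theta_0)}{\pi(\theta_2)}\,\frac{\sqrt{I(\theta_2)}}{2\sqrt{\pi_\circ}}\sqrt{n}\,w^n\quad\text{as }n\to\infty,$$ where $$\theta_2=\eta^{-1}\left(\frac{\eta(\theta_0)+\eta(\theta_1)}{2}\right)\in\Theta\quad\text{and}\quad w=\left(\int_{\mathcal{X}}\sqrt{p_{\theta_0}(x)\,p_{\theta_1}(x)}\,\mathrm{d}\nu(x)\right)^2.$$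
   Context: Setting. $\mathcal{X}\subseteq\mathbb{R}$ is the space of observations and $\nu$ is a $\sigma$-finite measure on the Borel sets of $\mathcal{X}$ (e.g. counting measure or Lebesgue measure). The parameter space $\Theta\subseteq\mathbb{R}$ is a convex set, and the prior on $\Theta$ is a probability measure with density $\pi$ with respect to Lebesgue measure, continuous and strictly positive on $\Theta$. For each $\theta\in\Theta$ the conditional probability $\mathbb{P}_\theta$ on $\mathcal{X}$ has density $p_\theta(x)=\exp(\eta(\theta)T(x)-A(\eta(\theta))-B(x))$ with respect to $\nu$, for some functions $\eta,T,A,B$, where $\eta$ is differentiable and $\eta'(\theta)>0$ for all $\theta\in\Theta$. (It is well known that $A$ is determined by $B$ and $T$, is infinitely differentiable, and that $A'(\eta(\theta))=\mathbb{E}_\theta[T(x)]$ and $A''(\eta(\theta))=\mathrm{Var}_\theta(T(x))$.) It is assumed that $A''(\eta(\theta))>0$ (that is, $T(x)$ is not $\mathbb{P}_\theta$-a.s. constant) for all $\theta\in\Theta$. The Fisher information is $I(\theta)=\mathbb{E}_\theta[(\partial_\theta\log p_\theta(x))^2]=\mathrm{Var}_\theta(T(x))\,(\eta'(\theta))^2$. For $s_n=(x_1,\ldots,x_n)$ put $p_\theta(s_n)=\prod_{i=1}^n p_\theta(x_i)$ and $p(s_n)=\int_\Theta p_\theta(s_n)\pi(\theta)\,\mathrm{d}\theta$. The posterior density at $\theta_0$ is $q_n^{\theta_0}(s_n)=p_{\theta_0}(s_n)\pi(\theta_0)/p(s_n)$, and $\mathbb{E}_{\theta_1}$ denotes expectation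 when $x_1,x_2,\ldots$ are iid with density $p_{\theta_1}$, so $$\mathbb{E}_{\theta_1}[q_n^{\theta_0}]=\int_{\mathcal{X}^n}\frac{p_{\theta_0}(s_n)\pi(\theta_0)}{p(s_n)}\,p_{\theta_1}(s_n)\,\mathrm{d}\nu^n(s_n).$$ $f(n)\sim g(n)$ means $\lim_{n\to\infty}f(n)/g(n)=1$. *)

(* Defs.v *)
From HB Require Import structures.
From mathcomp Require Import all_boot all_order all_algebra.
From mathcomp Require Import all_classical all_reals all_analysis.

Set Implicit Arguments.
Unset Strict Implicit.
Unset Printing Implicit Defensive.
Import Order.TTheory GRing.Theory Num.Theory.
Import numFieldNormedType.Exports.

Local Open Scope classical_set_scope.
Local Open Scope ring_scope.

(* Measurable types are pointed, so the subtype of R carved out by X comes with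
   a point x0; the point plays no other role. *)
Definition pointed_sub (R : realType) (X : set R) (x0 : X) : Type := set_type X.

HB.instance Definition _ (R : realType) (X : set R) (x0 : X) :=
  Choice.on (pointed_sub x0).
HB.instance Definition _ (R : realType) (X : set R) (x0 : X) :=
  isPointed.Build (pointed_sub x0) x0.

(* The Borel sigma-algebra of the (possibly non-measurable) subspace X of R is
   the trace of that of R, i.e. its preimage under the inclusion. *)
Definition borel_sub (R : realType) (X : set R) (x0 : X) :=
  g_sigma_algebra_preimageType (fun x : pointed_sub x0 => (val x : R)).

(* Product measure nu^n on T^n, with T^(n+1) identified with T * T^n. *)
Fixpoint power_measure d (T : measurableType d) (R : realType)
    (nu : set T -> \bar R) (n : nat) {struct n} :
    set (n.-tuple T) -> \bar R :=
  match n with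
  | 0%N => fun S => (\d_ ([tuple] : 0.-tuple T) S)
  | m.+1 => pushforward (product_measure1 nu (@power_measure d T R nu m))
              (fun xs : T * m.-tuple T => cons_tuple xs.1 xs.2)
  end.
Arguments power_measure {d T R} nu n.

(* Derivative of f at t relative to D: one-sided at an endpoint of an
   interval D, and the usual derivative at an interior point. *)
Section relative_derivative.
Variables (R : realType) (D : set R) (f : R -> R) (t : R).

Definition diff_quotient_within : set_system R :=
  (f u - f t) / (u - t) @[u --> within D t^'].

Definition derivable_within : Prop := cvg diff_quotient_within.

Definition derive_within : R := lim diff_quotient_within.

End relative_derivative.

Definition asymptotic (R : realType) (f g : nat -> \bar R) : Prop :=
  (f n / g n)%E @[n --> \oo] --> 1%E.

Section exponential_family.
Variables (R : realType) (d : measure_display) (X : measurableType d).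
Variable nu : {measure set X -> \bar R}.
Variable Theta : set R.
Variables (eta A : R -> R) (T B : X -> R).
Variable prior : R -> R.

Definition density (theta : R) (x : X) : R :=
  expR (eta theta * T x - A (eta theta) - B x).

Definition model (theta : R) (S : set X) : \bar R :=
  (\int[nu]_(x in S) (density theta x)%:E)%E.

Definition fisher_info (theta : R) : R :=
  \int[nu]_x (derive_within Theta (fun t => ln (density t x)) theta ^+ 2
                * density theta x).

Definition likelihood (theta : R) (n : nat) (s : n.-tuple X) : R :=
  \prod_(i < n) density theta (tnth s i).

Definition evidence (n : nat) (s : n.-tuple X) : \bar R :=
  (\int[lebesgue_measure]_(theta in Theta)
    (likelihood theta s * prior theta)%:E)%E.

(* The evidence is positive but may be +oo on a null set of samples, where
   this quotient is 0. *)
Definition posterior (theta0 : R) (n : nat) (s : n.-tuple X) : \bar R :=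
  ((likelihood theta0 s * prior theta0)%:E / evidence s)%E.

Definition expected_posterior (theta1 theta0 : R) (n : nat) : \bar R :=
  (\int[power_measure nu n]_s
    (posterior theta0 s * (likelihood theta1 s)%:E))%E.

Definition affinity (theta0 theta1 : R) : R :=
  (\int[nu]_x Num.sqrt (density theta0 x * density theta1 x)) ^+ 2.

End exponential_family.

(* Main.v *)
Require Import Defs.
From HB Require Import structures.
From mathcomp Require Import all_boot all_order all_algebra.
From mathcomp Require Import all_classical all_reals all_analysis.
From mathcomp Require Import measurable_realfun ring lra.

(** Dividing the numerator and the evidence by the likelihood at [t0] shows that
    the posterior density at an interior parameter [t0] depends on the sample
    only through the sum [S] of the scores at [t0] ([posterior_tilt]):

      posterior = prior t0 / \int_Theta expR (h t * S - n * K t) * prior t dt,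

    where [h t = (eta t - eta t0) / eta' t0] is the recentred natural parameter
    and [K t] is the cumulant function of the score at [h t].  Near [t0],
    [h t] behaves like [t - t0] and [K t] like [I / 2 * (t - t0) ^+ 2], with [I]
    the Fisher information, so that Laplace's method gives, uniformly in [S]
    ([posterior_profile]),

      posterior / sqrt n = sqrt (I / (2 pi)) * expR (- S ^+ 2 / (2 n I)) + o(1).

    Uniformity on the whole line, and not only for [S] of order [sqrt n], allows
    this to be integrated against the law of the sample.  Under that law
    [S / sqrt (n I)] is asymptotically a standard Gaussian [Z], and the
    expectation of [expR (- Z ^+ 2 / 2)] is [1 / sqrt 2], which yields the
    constant [sqrt (I / (2 pi)) / sqrt 2 = sqrt I / (2 sqrt pi)]
    ([expected_posterior_estimate]).

    The central limit theorem is needed for one test function only,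
    [expR (- x ^+ 2 / 2)], which is the heat kernel at time 1 up to a constant.
    Averaging over a small centred increment of the walk moves the heat kernel
    forward in time by the variance of the increment, up to a third-order error;
    [n] such steps lead from time 1 to time 2, where the value at the origin is
    [1 / sqrt 2] ([gaussian_functional_clt]).

    All information on [K] comes from the densities having mass one, which says
    that [expR (K t)] is the moment generating function of the score at [h t].  Since [t0] is interior,
    the score has exponential moments of both signs; they give the quadratic
    expansion of [K] at [t0] ([cumulant_near]), and with it the value of the
    score and of the Fisher information ([score_eq], [fisher_info_eq]).  Away
    from [t0], Bernoulli's inequality makes [K] grow at least linearly in [h]
    ([cumulant_star], [cumulant_far]), so that distant parameters contribute an
    exponentially small mass.

    For two different parameters, the product of the densities at [t0] and [t1]
    is [w] times the squared density at the point [t2] whose natural parameter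
    is the midpoint ([density_midpoint]).  The identity between expected
    posterior densities is therefore exact, and [t2] lies strictly between [t0]
    and [t1], hence in the interior of [Theta] even when [t0] and [t1] are
    endpoints, so that the first part applies at [t2]. *)

Set Implicit Arguments.
Unset Strict Implicit.
Unset Printing Implicit Defensive.
Import Order.TTheory GRing.Theory Num.Theory.
Import numFieldNormedType.Exports.
Local Open Scope classical_set_scope.
Local Open Scope ring_scope.

(** * Taylor remainders *)

Section taylor.
Context {R : realType}.
Implicit Types (x y k M : R) (f g df : R -> R).

Lemma mean_value_bound f df x k M :
  (forall z, `|z - x| <= `|k| -> is_derive z 1 f (df z)) ->
  (forall z, `|z - x| <= `|k| -> `|df z| <= M) ->
  `|f (x + k) - f x| <= M * `|k|.
Proof.
move=> fdf dfM.
have cf a b : (forall z, a <= z <= b -> `|z - x| <= `|k|) ->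
    {within `[a, b], continuous f}.
  move=> ab; apply: derivable_within_continuous => z; rewrite in_itv/= => zab.
  by apply: ex_derive; exact/fdf/ab.
have [k0|k0] := leP 0 k.
  have zk z : x <= z <= x + k -> `|z - x| <= `|k|.
    by move=> /andP[xz zk]; rewrite !ger0_norm ?subr_ge0//; lra.
  have [|||c /[!in_itv]/= cxk ->] := @MVT_segment R f df x (x + k).
  - lra.
  - move=> z; rewrite in_itv/= => /andP[? ?].
    by apply/fdf/zk; apply/andP; split; exact: ltW.
  - exact: cf.
  by rewrite [x + k]addrC addrK normrM ler_wpM2r//; exact/dfM/zk.
have zk z : x + k <= z <= x -> `|z - x| <= `|k|.
  move=> /andP[xz zx]; rewrite (ltr0_norm k0) ler0_norm ?subr_le0//; lra.
have [|||c /[!in_itv]/= cxk e] := @MVT_segment R f df (x + k) x.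
- lra.
- move=> z; rewrite in_itv/= => /andP[? ?].
  by apply/fdf/zk; apply/andP; split; exact: ltW.
- exact: cf.
rewrite distrC e normrM (_ : x - (x + k) = - k); last by ring.
by rewrite normrN ler_wpM2r//; exact/dfM/zk.
Qed.

(** Each order is obtained from the preceding one by applying the mean value
    bound to the remainder, at the price of the factorial in the constant. *)
Lemma taylor1_bound g g1 g2 x k M :
  (forall z, `|z - x| <= `|k| -> is_derive z 1 g (g1 z)) ->
  (forall z, `|z - x| <= `|k| -> is_derive z 1 g1 (g2 z)) ->
  (forall z, `|z - x| <= `|k| -> `|g2 z| <= M) ->
  `|g (x + k) - g x - g1 x * k| <= M * `|k| ^+ 2.
Proof.
move=> gg1 g1g2 g2M.
pose f j := g j - g1 x * (j - x).
have -> : g (x + k) - g x - g1 x * k = f (x + k) - f x by rewrite /f; ring.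
rewrite expr2 mulrA; apply: (@mean_value_bound _ (fun j => g1 j - g1 x)).
  move=> z zk; have ? := gg1 _ zk; apply: is_derive_eq.
  by rewrite /GRing.scale/=; ring.
move=> z zk; rewrite -[X in g1 X - _](subrKC x).
apply: (le_trans (@mean_value_bound g1 g2 x (z - x) M _ _)).
- by move=> y yz; exact/g1g2/(le_trans yz).
- by move=> y yz; exact/g2M/(le_trans yz).
- by apply: ler_wpM2l => //; apply: le_trans (g2M x _); rewrite ?subrr ?normr0.
Qed.

Lemma taylor2_bound g g1 g2 g3 x k M :
  (forall z, `|z - x| <= `|k| -> is_derive z 1 g (g1 z)) ->
  (forall z, `|z - x| <= `|k| -> is_derive z 1 g1 (g2 z)) ->
  (forall z, `|z - x| <= `|k| -> is_derive z 1 g2 (g3 z)) ->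
  (forall z, `|z - x| <= `|k| -> `|g3 z| <= M) ->
  `|g (x + k) - g x - g1 x * k - g2 x * k ^+ 2 / 2| <= M * `|k| ^+ 3.
Proof.
move=> gg1 g1g2 g2g3 g3M.
pose f j := g j - g1 x * (j - x) - g2 x / 2 * (j - x) ^+ 2.
have -> : g (x + k) - g x - g1 x * k - g2 x * k ^+ 2 / 2 = f (x + k) - f x.
  by rewrite /f; field.
rewrite exprSr mulrA.
apply: (@mean_value_bound _ (fun j => g1 j - g1 x - g2 x * (j - x))).
  move=> z zk; have ? := gg1 _ zk; apply: is_derive_eq.
  by rewrite /GRing.scale/=; field.
move=> z zk; rewrite -[X in g1 X - _ - _](subrKC x).
apply: (le_trans (@taylor1_bound g1 g2 g3 x (z - x) M _ _ _)).
- by move=> y yz; exact/g1g2/(le_trans yz).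
- by move=> y yz; exact/g2g3/(le_trans yz).
- by move=> y yz; exact/g3M/(le_trans yz).
- apply: ler_wpM2l; last by rewrite lerXn2r// nnegrE.
  by apply: le_trans (g3M x _); rewrite ?subrr ?normr0.
Qed.

End taylor.

(** * The heat kernel *)

Section heat_kernel.
Context {R : realType}.
Implicit Types (s x k : R).

(** Without the factor [(2 * pi) ^ (- 1 / 2)] the kernel at time 1 is exactly
    [expR (- x ^+ 2 / 2)]; the factor [s ^ (- 1 / 2)] is put in the
    exponent. *)
Definition heat s x : R := expR (- x ^+ 2 / (2 * s) - ln s / 2).

Definition heat_x s x := - (x / s) * heat s x.

Definition heat_xx s x := (x ^+ 2 / s ^+ 2 - s^-1) * heat s x.

Definition heat_xxx s x := (3 * x / s ^+ 2 - x ^+ 3 / s ^+ 3) * heat s x.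

Definition heat_ss s x :=
  (3 / (4 * s ^+ 2) - 3 * x ^+ 2 / (2 * s ^+ 3) + x ^+ 4 / (4 * s ^+ 4)) *
  heat s x.

Lemma is_derive_heat s x : 0 < s -> is_derive x 1 (heat s) (heat_x s x).
Proof.
move=> s0; apply: is_derive_eq.
by rewrite /heat_x /heat /GRing.scale/=; field; rewrite gt_eqF.
Qed.

Lemma is_derive_heat_x s x : 0 < s -> is_derive x 1 (heat_x s) (heat_xx s x).
Proof.
move=> s0; have ? := is_derive_heat x s0; apply: is_derive_eq.
by rewrite /heat_xx /heat_x /GRing.scale/=; field; rewrite gt_eqF.
Qed.

Lemma is_derive_heat_xx s x : 0 < s -> is_derive x 1 (heat_xx s) (heat_xxx s x).
Proof.
move=> s0; have ? := is_derive_heat x s0; apply: is_derive_eq.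
by rewrite /heat_xxx /heat_xx /heat_x /GRing.scale/=; field; rewrite gt_eqF.
Qed.

(** This is the heat equation, by which a Gaussian increment of variance [d]
    amounts to a time step of length [d]. *)
Lemma is_derive_heat_time s x : 0 < s ->
  is_derive s 1 (heat ^~ x) (heat_xx s x / 2).
Proof.
move=> s0; have ? := is_derive1_ln s0.
have ? : is_derive s 1 (fun s : R => (2 * s)^-1) (- (2 * s ^+ 2)^-1).
  have ? : 2 * s != 0 by rewrite mulf_neq0// gt_eqF.
  apply: is_derive_eq; rewrite /GRing.scale/=; field; by rewrite gt_eqF.
apply: is_derive_eq.
by rewrite /heat_xx /heat /GRing.scale/=; field; rewrite gt_eqF.
Qed.

Lemma is_derive_heat_xx_time s x : 0 < s ->
  is_derive s 1 (fun s => heat_xx s x / 2) (heat_ss s x).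
Proof.
move=> s0; have ? := is_derive_heat_time x s0.
have sn0 : s != 0 by rewrite gt_eqF.
have -> : (fun s => heat_xx s x / 2) =
    (fun s : R => (x ^+ 2 * (s^-1) ^+ 2 - s^-1) * heat s x / 2).
  by apply/funext => t; rewrite /heat_xx exprVn.
have ? : is_derive s 1 (fun s : R => s^-1) (- (s ^+ 2)^-1).
  have := @is_deriveV R id s 1 1 sn0 _; rewrite /GRing.scale/= mulr1; exact.
apply: is_derive_eq.
by rewrite /heat_ss /heat_xx /GRing.scale/=; field.
Qed.

(** Times between [1 / 2] and [3] surround the range from 1 to 2 that is
    traversed in steps of length at most [1 / 2].  The bound is
    [2 * (1 + 12 ^ 2)], from [x ^+ 2 / 12 <= expR (x ^+ 2 / 12) - 1]. *)
Lemma heat_decay s x : 2^-1 <= s <= 3 ->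
  0 <= heat s x /\ (1 + x ^+ 4) * heat s x <= 290.
Proof.
move=> /andP[s1 s3]; have s0 : 0 < s by apply: lt_le_trans s1; rewrite invr_gt0.
split; first exact: expR_ge0.
have ln2 : - ln s / 2 <= 2^-1.
  suff : - ln s <= 1 by lra.
  rewrite -lnV ?posrE//.
  have s2 : s^-1 <= 2 by rewrite invf_ple ?posrE.
  have si : 0 < s^-1 by rewrite invr_gt0.
  have := @le_ln1Dx R (s^-1 - 1); rewrite subrKC => h.
  by apply: (le_trans (h _)); lra.
have e2 : expR (2^-1) <= 2 :> R.
  have := @expR_ge1Dx R (- 2^-1); rewrite expRN => h.
  have h0 : 0 < expR 2^-1 :> R by exact: expR_gt0.
  have : (1 - 2^-1) * expR 2^-1 <= 1 :> R by rewrite -ler_pdivlMr ?div1r.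
  lra.
have hE : heat s x <= 2 * expR (- (x ^+ 2 / 6)).
  rewrite /heat -mulNr expRD mulrC ler_pM ?expR_ge0//.
    by rewrite mulNr in ln2; rewrite (le_trans _ e2)// ler_expR.
  rewrite ler_expR !mulNr lerN2 ler_wpM2l ?sqr_ge0// lef_pV2 ?posrE//; lra.
apply: (@le_trans _ _ ((1 + x ^+ 4) * (2 * expR (- (x ^+ 2 / 6))))).
  by rewrite ler_wpM2l// addr_ge0// exprn_even_ge0.
rewrite expRN.
have e0 : 0 < expR (x ^+ 2 / 6) :> R by exact: expR_gt0.
rewrite mulrA ler_pdivrMr//.
have h12 := @expR_ge1Dx R (x ^+ 2 / 12).
have -> : x ^+ 2 / 6 = x ^+ 2 / 12 + x ^+ 2 / 12 by field.
rewrite expRD.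
have x2 : 0 <= x ^+ 2 by exact: sqr_ge0.
have : (1 + x ^+ 2 / 12) ^+ 2 <= expR (x ^+ 2 / 12) ^+ 2.
  by rewrite lerXn2r// ?nnegrE ?expR_ge0//; lra.
rewrite (_ : x ^+ 4 = x ^+ 2 * x ^+ 2); last by rewrite -exprD.
move: x2 h12; set q := x ^+ 2; set e := expR _ => q0 h12 h.
have e1 : 0 <= e - 1 by lra.
rewrite !expr2 in h; nra.
Qed.

(** The polynomial factors of the two derivatives have degree at most 4 in [x],
    with coefficients of total size at most 20; here [5800 = 20 * 290]. *)
Lemma heat_third_bound s x : 2^-1 <= s <= 3 ->
  `|heat_xxx s x| <= 5800 /\ `|heat_ss s x| <= 5800.
Proof.
move=> s13; have [h0 hb] := heat_decay x s13; move/andP: s13 => [s1 s3].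
have s0 : 0 < s by apply: lt_le_trans s1; rewrite invr_gt0.
pose r := s^-1; have r0 : 0 <= r by rewrite invr_ge0 ltW.
have r2 : r <= 2 by rewrite /r invf_ple ?posrE.
have y0 := normr_ge0 x; set y := `|x| in y0.
have x4 : x ^+ 4 = y ^+ 4 by rewrite -normrX ger0_norm// exprn_even_ge0.
have rX (j : nat) : r ^+ j <= 2 ^+ j by rewrite lerXn2r// nnegrE.
have rX0 (j : nat) : 0 <= r ^+ j by exact: exprn_ge0.
have yX (j : nat) : 0 <= y ^+ j by exact: exprn_ge0.
have yle j : (0 < j <= 4)%N -> y ^+ j <= 1 + y ^+ 4.
  move=> /andP[j0 j4]; have [y1|/ltW y1] := leP y 1.
    by have := exprn_ile1 j y0 y1; have := yX 4%N; lra.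
  by have := ler_weXn2l y1 j4; lra.
have y1 := yle 1%N isT; have y2 := yle 2%N isT; have y3 := yle 3%N isT.
rewrite expr1 in y1.
have xr j l : - (2 ^+ l * y ^+ j) <= x ^+ j * r ^+ l <= 2 ^+ l * y ^+ j.
  rewrite -ler_norml [`|_|]normrM normrX [`|r ^+ l|]normrX (ger0_norm r0) mulrC.
  by rewrite ler_wpM2r.
suff pol P : `|P| <= 20 * (1 + y ^+ 4) -> `|P * heat s x| <= 5800.
  split; apply: pol.
    rewrite (_ : _ - _ = 3 * (x ^+ 1 * r ^+ 2) - x ^+ 3 * r ^+ 3); last first.
      by rewrite /r; field; rewrite gt_eqF.
    have := xr 1%N 2%N; have := xr 3%N 3%N; rewrite expr1.
    by rewrite ler_norml; lra.
  rewrite (_ : _ + _ = 3 / 4 * r ^+ 2 - 3 / 2 * (x ^+ 2 * r ^+ 3) +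
      4^-1 * (x ^+ 4 * r ^+ 4)); last by rewrite /r; field; rewrite gt_eqF.
  have := xr 2%N 3%N; have := xr 4%N 4%N; have := rX 2%N; have := rX0 2%N.
  by rewrite ler_norml; lra.
move=> Pb; rewrite normrM (ger0_norm h0).
rewrite x4 in hb; have := ler_wpM2r h0 Pb; nra.
Qed.

(** The terms in [k] and in [k ^+ 2 - d] average to 0 when the increment [k] is
    centred with variance [d]; the right-hand side is then the price of
    replacing a Gaussian increment of variance [d] by [k]. *)
Definition lindeberg_bound (M : R) := forall s x k d,
  1 <= s <= 2 -> 0 <= d <= 2^-1 ->
  `|heat s (x + k) - heat (s + d) x - heat_x s x * k
    - heat_xx s x * (k ^+ 2 - d) / 2| <= M * (`|k| ^+ 3 + d ^+ 2).

Lemma lindeberg_bound_exists : exists2 M, 0 <= M & lindeberg_bound M.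
Proof.
exists 5800; first exact: ler0n.
move=> s x k d /andP[s1 s2] /andP[d0 d1].
have zs z : `|z - s| <= `|d| -> 2^-1 <= z <= 3.
  by rewrite (ger0_norm d0) ler_norml; lra.
have t3 : `|heat s (x + k) - heat s x - heat_x s x * k
    - heat_xx s x * k ^+ 2 / 2| <= 5800 * `|k| ^+ 3.
  apply: (@taylor2_bound R (heat s) (heat_x s) (heat_xx s) (heat_xxx s)) => z _.
  - by apply: is_derive_heat; lra.
  - by apply: is_derive_heat_x; lra.
  - by apply: is_derive_heat_xx; lra.
  - by apply: (heat_third_bound _ _).1; lra.
have t2 : `|heat (s + d) x - heat s x - heat_xx s x / 2 * d| <=
    5800 * `|d| ^+ 2.
  apply: (@taylor1_bound R (heat ^~ x) (fun s => heat_xx s x / 2)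
    (heat_ss ^~ x)) => z /zs zb.
  - by apply: is_derive_heat_time; lra.
  - by apply: is_derive_heat_xx_time; lra.
  - by apply: (heat_third_bound _ _).2; lra.
rewrite (ger0_norm d0) in t2.
rewrite [leRHS]mulrDr; apply: le_trans (lerD t3 t2).
apply: (le_trans _ (ler_normB _ _)); rewrite le_eqVlt; apply/orP; left.
by apply/eqP; congr (`|_|); field.
Qed.

End heat_kernel.

(** * Integration against powers of a measure *)

Section power_measure.
Context d (X : measurableType d) (R : realType).
Variable nu : {sigma_finite_measure set X -> \bar R}.
Local Open Scope ereal_scope.

Let consp n (z : X * n.-tuple X) : n.+1.-tuple X := cons_tuple z.1 z.2.

Let measurable_consp n : measurable_fun [set: X * n.-tuple X] (@consp n).
Proof. exact: measurable_cons. Qed.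

(** A bare set function has no measure structure; the recursion defining the
    power measure preserves the existence of one. *)
Lemma power_measure_sigma_finite n :
  exists m : {sigma_finite_measure set (n.-tuple X) -> \bar R},
    power_measure nu n = m :> (set (n.-tuple X) -> \bar R).
Proof.
elim: n => [|n [m mE]].
  by exists (\d_ ([tuple] : 0.-tuple X) :
    {sigma_finite_measure set (0.-tuple X) -> \bar R}).
pose M := pushforward (nu \x m) (@consp n).
pose MM : {measure set (n.+1.-tuple X) -> \bar R} :=
  measure_function_pushforward__canonical__measure_function_Measure
    (nu \x m) (@measurable_consp n).
have Msf : sigma_finite setT (MM : set _ -> \bar R).
  have [F FT Foo] : sigma_finite setT (nu \x m).
    have /sigma_finiteP[F1 [T1 nd1 oo1]] := sigma_finiteT nu.
    have /sigma_finiteP[F2 [T2 nd2 oo2]] := sigma_finiteT m.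
    exists (fun k => F1 k `*` F2 k).
      rewrite eqEsubset; split => // -[x y] _.
      have [i _ F1x] : (\bigcup_k F1 k) x by rewrite -T1.
      have [j _ F2y] : (\bigcup_k F2 k) y by rewrite -T2.
      exists (maxn i j) => //; split => /=.
        by move: x F1x {T1 oo1}; apply/subsetPset/nd1/leq_maxl.
      by move: y F2y {T2 oo2}; apply/subsetPset/nd2/leq_maxr.
    move=> k; have [m1 f1] := oo1 k; have [m2 f2] := oo2 k.
    split; first exact: measurableX.
    by rewrite product_measure1E// lte_mul_pinfty// ge0_fin_numE.
  pose g (t : n.+1.-tuple X) : X * n.-tuple X := (thead t, [tuple of behead t]).
  have mg : measurable_fun setT g.
    apply: measurable_fun_pair; first exact: measurable_tnth.
    exact: measurable_behead.
  have gK : cancel (@consp n) g.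
    by move=> [x t]; rewrite /g /consp/=; congr pair; apply/val_inj.
  exists (fun k => g @^-1` F k).
    by rewrite -preimage_bigcup -FT preimage_setT.
  move=> k; have [mFk Fk] := Foo k; split.
    by rewrite -[X in measurable X]setTI; exact: mg.
  rewrite /= /M /pushforward -comp_preimage.
  rewrite (_ : g \o @consp n = id) ?preimage_id//.
  by apply/funext => z; exact: gK.
pose Ms := Measure_isSigmaFinite.Build _ _ _ (MM : set _ -> \bar R) Msf.
pose MS : {sigma_finite_measure set (n.+1.-tuple X) -> \bar R} :=
  HB.pack (MM : set _ -> \bar R) (Measure.class MM) Ms.
by exists MS; rewrite /= mE.
Qed.

Lemma integral_power_measure0 (f : 0.-tuple X -> \bar R) :
  measurable_fun setT f ->
  \int[power_measure nu 0]_s f s = f [tuple].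
Proof.
move=> mf; transitivity (\int[\d_ ([tuple] : 0.-tuple X)]_s f s).
  exact: eq_measure_integral.
by rewrite integral_dirac// diracT mul1e.
Qed.

Lemma integral_power_measureS n (f : n.+1.-tuple X -> \bar R) :
  measurable_fun setT f -> (forall s, 0 <= f s) ->
  \int[power_measure nu n.+1]_s f s =
  \int[nu]_x \int[power_measure nu n]_s f (cons_tuple x s).
Proof.
move=> mf f0; have [m mE] := power_measure_sigma_finite n.
rewrite /= mE (ge0_integral_pushforward (@measurable_consp n))// preimage_setT.
rewrite fubini_tonelli1//.
  exact: (measurableT_comp mf (measurable_consp (n := n))).
by move=> z; exact: f0.
Qed.

End power_measure.

(** * Sums of independent observations *)

Section random_walk.
Context d (X : measurableType d) (R : realType).
Variable nu : {sigma_finite_measure set X -> \bar R}.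
Variables (p Y : X -> R).
Hypothesis p0 : forall x, 0 <= p x.
Hypothesis mp : measurable_fun setT p.
Hypothesis mY : measurable_fun setT Y.
Local Open Scope ereal_scope.

Implicit Types g h : R -> \bar R.

(** The transition operator of the random walk whose increments are distributed
    as [Y] under the density [p]. *)
Definition walk_step g (y : R) : \bar R :=
  \int[nu]_x ((p x)%:E * g (y + Y x)%R).

Lemma walk_step_ge0 g y : (forall z, 0 <= g z) -> 0 <= walk_step g y.
Proof.
by move=> g0; apply: integral_ge0 => x _; rewrite mule_ge0// lee_fin.
Qed.

Let measurable_walk_integrand g y : measurable_fun setT g ->
  measurable_fun setT (fun x => (p x)%:E * g (y + Y x)%R).
Proof.
move=> mg; apply: emeasurable_funM; first exact/measurable_EFinP.
by apply: (measurableT_comp mg); exact: measurable_funD.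
Qed.

Lemma measurable_walk_step g : measurable_fun setT g -> (forall z, 0 <= g z) ->
  measurable_fun setT (walk_step g).
Proof.
move=> mg g0.
pose f (z : R * X) := (p z.2)%:E * g (z.1 + Y z.2)%R.
apply: (measurable_fun_fubini_tonelli_F (m2 := nu) f).
  apply: emeasurable_funM.
    by apply/measurable_EFinP; exact: measurableT_comp.
  apply: (measurableT_comp mg).
  by apply: measurable_funD => //; exact: measurableT_comp.
by move=> z; rewrite mule_ge0// lee_fin.
Qed.

Lemma le_walk_step g h y : measurable_fun setT g -> measurable_fun setT h ->
  (forall z, 0 <= g z <= h z) -> walk_step g y <= walk_step h y.
Proof.
move=> mg mh gh; apply: ge0_le_integral => //.
- by move=> x _; rewrite mule_ge0 ?lee_fin//; have /andP[] := gh (y + Y x)%R.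
- exact: measurable_walk_integrand.
- exact: measurable_walk_integrand.
- by move=> x _; rewrite lee_wpmul2l ?lee_fin//; have /andP[] := gh (y + Y x)%R.
Qed.

Lemma walk_stepD_cst g (c : R) y :
  measurable_fun setT g -> (forall z, 0 <= g z) ->
  \int[nu]_x (p x)%:E = 1 -> (0 <= c)%R ->
  walk_step (fun z => g z + c%:E) y = walk_step g y + c%:E.
Proof.
move=> mg g0 p1 c0; rewrite /walk_step.
under eq_integral do rewrite ge0_muleDr//.
rewrite ge0_integralD//=.
- rewrite ge0_integralZr ?p1 ?mul1e//=; first exact/measurable_EFinP.
  by move=> x _; rewrite lee_fin.
- by move=> x _; rewrite mule_ge0 ?lee_fin.
- exact: measurable_walk_integrand.
- by move=> x _; rewrite mule_ge0 ?lee_fin.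
- apply: emeasurable_funM; [exact/measurable_EFinP|exact: measurable_cst].
Qed.

Lemma iter_walk_step k g : measurable_fun setT g -> (forall z, 0 <= g z) ->
  measurable_fun setT (iter k walk_step g) /\
  forall z, 0 <= iter k walk_step g z.
Proof.
move=> mg g0; elim: k => [//|k [mk k0]] /=; split.
  exact: measurable_walk_step.
by move=> z; exact: walk_step_ge0.
Qed.

Definition sample_density n (s : n.-tuple X) : R := \prod_(i < n) p (tnth s i).

Definition sample_sum n (s : n.-tuple X) : R := \sum_(i < n) Y (tnth s i).

Lemma sample_density_ge0 n (s : n.-tuple X) : (0 <= sample_density s)%R.
Proof. exact: prodr_ge0. Qed.

Lemma measurable_sample_density n : measurable_fun setT (@sample_density n).
Proof.
apply: measurable_prod => i _; apply: measurableT_comp => //.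
exact: measurable_tnth.
Qed.

Lemma measurable_sample_sum n : measurable_fun setT (@sample_sum n).
Proof.
apply: measurable_sum => i; apply: measurableT_comp => //.
exact: measurable_tnth.
Qed.

Lemma measurable_sample_integrand n g y : measurable_fun setT g ->
  measurable_fun [set: n.-tuple X]
    (fun s => (sample_density s)%:E * g (y + sample_sum s)%R).
Proof.
move=> mg; apply: emeasurable_funM.
  by apply/measurable_EFinP; exact: measurable_sample_density.
apply: (measurableT_comp mg); apply: measurable_funD => //.
exact: measurable_sample_sum.
Qed.

(** Splitting off the first observation reduces an integral over samples to the
    iterated transition operator, so that a central limit theorem can be proved
    one increment at a time. *)
Lemma integral_sample_sum n g y :
  measurable_fun setT g -> (forall z, 0 <= g z) ->
  \int[power_measure nu n]_s ((sample_density s)%:E * g (y + sample_sum s)%R) =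
  iter n walk_step g y.
Proof.
move=> mg g0; elim: n y => [|n ih] y.
  rewrite integral_power_measure0; last exact: measurable_sample_integrand.
  by rewrite /sample_density /sample_sum !big_ord0 addr0 mul1e.
rewrite integral_power_measureS; last 2 first.
- exact: measurable_sample_integrand.
- by move=> s; rewrite mule_ge0// lee_fin sample_density_ge0.
rewrite iterS; apply: eq_integral => x _; rewrite -ih.
have [m mE] := power_measure_sigma_finite nu n; rewrite mE.
rewrite -ge0_integralZl_EFin//.
- apply: eq_integral => s _; rewrite muleA -EFinM.
  rewrite /sample_density /sample_sum !big_ord_recl.
  congr (_%:E * g _)%E.
    by congr (_ * _)%R; apply: eq_bigr => i _; rewrite tnthS.
  by rewrite addrA; congr (_ + _)%R; apply: eq_bigr => i _; rewrite tnthS.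
- by move=> s _; rewrite mule_ge0// lee_fin sample_density_ge0.
- exact: measurable_sample_integrand.
Qed.

End random_walk.

(** * Real-valued integrals *)

Section real_integrable.
Context d (X : measurableType d) (R : realType).
Variable nu : {measure set X -> \bar R}.
Implicit Types f g : X -> R.

Lemma integrable_rZl k f : nu.-integrable setT (EFin \o f) ->
  nu.-integrable setT (EFin \o (fun x => k * f x)).
Proof. by move=> /(integrableZl measurableT k). Qed.

Lemma integrable_rD f g : nu.-integrable setT (EFin \o f) ->
  nu.-integrable setT (EFin \o g) ->
  nu.-integrable setT (EFin \o (fun x => f x + g x)).
Proof. by move=> fi /(integrableD measurableT fi). Qed.

Lemma integrable_le f g : measurable_fun setT f ->
  (forall x, `|f x| <= g x) -> nu.-integrable setT (EFin \o g) ->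
  nu.-integrable setT (EFin \o f).
Proof.
move=> mf fg; apply: le_integrable => //; first exact/measurable_EFinP.
by move=> x _ /=; rewrite lee_fin (le_trans (fg x))// ler_norm.
Qed.

Lemma integral_EFin_Rintegral f : nu.-integrable setT (EFin \o f) ->
  (\int[nu]_x (f x)%:E = (\int[nu]_x f x)%:E)%E.
Proof. by move=> fi; rewrite /Rintegral fineK//; exact: integrable_fin_num. Qed.

Lemma dist_Rintegral_le f g h : nu.-integrable setT (EFin \o f) ->
  nu.-integrable setT (EFin \o g) -> nu.-integrable setT (EFin \o h) ->
  (forall x, `|f x - g x| <= h x) ->
  `|\int[nu]_x f x - \int[nu]_x g x| <= \int[nu]_x h x.
Proof.
move=> fi gi hi fgh; have fgi := integrable_rD fi (integrable_rZl (-1) gi).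
have -> : \int[nu]_x f x - \int[nu]_x g x = \int[nu]_x (f x + -1 * g x).
  rewrite RintegralD//; last exact: integrable_rZl.
  by rewrite RintegralZl// mulN1r.
apply: (le_trans (le_normr_Rintegral measurableT fgi)).
apply: le_Rintegral => //; first exact: integrable_norm.
by move=> x _; rewrite mulN1r.
Qed.

End real_integrable.

(** * A central limit theorem for a Gaussian test function *)

Section gaussian_clt.
Context d (X : measurableType d) (R : realType).
Variable nu : {sigma_finite_measure set X -> \bar R}.
Variables (p Y : X -> R) (v : R).
Hypothesis p0 : forall x, 0 <= p x.
Hypothesis mp : measurable_fun setT p.
Hypothesis mY : measurable_fun setT Y.
Hypothesis p1 : (\int[nu]_x (p x)%:E = 1)%E.
Hypothesis iY : nu.-integrable setT (EFin \o (fun x => p x * Y x)).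
Hypothesis iY2 : nu.-integrable setT (EFin \o (fun x => p x * Y x ^+ 2)).
Hypothesis iY3 : nu.-integrable setT (EFin \o (fun x => p x * `|Y x| ^+ 3)).
Hypothesis EY : \int[nu]_x (p x * Y x) = 0.
Hypothesis EY2 : \int[nu]_x (p x * Y x ^+ 2) = v.

Lemma continuous_heat (s : R) : 0 < s -> continuous (heat s).
Proof.
move=> s0 x; apply: differentiable_continuous; apply/derivable1_diffP.
by have [] := is_derive_heat x s0.
Qed.

Let measurable_heat (s : R) : 0 < s -> measurable_fun setT (heat s).
Proof.
by move=> s0; apply: continuous_measurable_fun => x; exact: continuous_heat.
Qed.

Let ip : nu.-integrable setT (EFin \o p).
Proof.
apply/integrableP; split; first exact/measurable_EFinP.
by under eq_integral do rewrite /= ger0_norm//; rewrite p1 ltry.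
Qed.

Let Ep : \int[nu]_x p x = 1.
Proof. by rewrite /Rintegral p1. Qed.

Let heat_le (s x : R) : 2^-1 <= s <= 3 -> heat s x <= 290.
Proof.
move=> /(heat_decay x)[h0 h]; apply: le_trans h; rewrite ler_peMl// lerDl.
exact: exprn_even_ge0.
Qed.

Let integrable_heat s (y r : R) : 1 <= s <= 2 ->
  nu.-integrable setT (EFin \o (fun x => p x * heat s (y + r * Y x))).
Proof.
move=> s12; apply: (@integrable_le _ _ _ _ _ (fun x => 290 * p x)).
- apply: measurable_funM => //; apply: measurableT_comp => //.
    by apply: measurable_heat; lra.
  by apply: measurable_funD => //; exact: measurable_funM.
- move=> x; rewrite ger0_norm ?mulr_ge0 ?expR_ge0// mulrC ler_wpM2r//.
  by apply: heat_le; lra.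
- exact: integrable_rZl.
Qed.

(** The increment of the walk matches a Gaussian increment of variance
    [r ^+ 2 * v] up to the second moment, so that one averaging step moves the
    heat kernel forward by that amount of time, with a third-order error. *)
Lemma heat_walk_step (M s y r : R) :
  lindeberg_bound M -> 1 <= s <= 2 -> 0 <= r -> 0 <= r ^+ 2 * v <= 2^-1 ->
  `|\int[nu]_x (p x * heat s (y + r * Y x)) - heat (s + r ^+ 2 * v) y| <=
  M * (r ^+ 3 * \int[nu]_x (p x * `|Y x| ^+ 3) + (r ^+ 2 * v) ^+ 2).
Proof.
move=> bM s12 r0 d12; set e := r ^+ 2 * v in d12 *.
pose c := heat (s + e) y - heat_xx s y * e / 2.
pose g x := c * p x + (heat_x s y * r * (p x * Y x) +
  heat_xx s y * r ^+ 2 / 2 * (p x * Y x ^+ 2)).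
have i1 := integrable_rZl (heat_x s y * r) iY.
have i2 := integrable_rZl (heat_xx s y * r ^+ 2 / 2) iY2.
have gi : nu.-integrable setT (EFin \o g).
  by apply: integrable_rD; [exact: integrable_rZl|exact: integrable_rD].
have <- : \int[nu]_x g x = heat (s + e) y.
  rewrite RintegralD//; [|exact: integrable_rZl|exact: integrable_rD].
  by rewrite RintegralD// !RintegralZl// EY EY2 Ep /c /e; field.
have hi : nu.-integrable setT
    (EFin \o (fun x => M * (r ^+ 3 * (p x * `|Y x| ^+ 3) + e ^+ 2 * p x))).
  by apply/integrable_rZl/integrable_rD; exact: integrable_rZl.
have -> : M * (r ^+ 3 * \int[nu]_x (p x * `|Y x| ^+ 3) + e ^+ 2) =
    \int[nu]_x (M * (r ^+ 3 * (p x * `|Y x| ^+ 3) + e ^+ 2 * p x)).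
  rewrite RintegralZl//; last by apply: integrable_rD; exact: integrable_rZl.
  by rewrite RintegralD ?RintegralZl ?Ep ?mulr1//; exact: integrable_rZl.
apply: dist_Rintegral_le => //; first exact: integrable_heat.
move=> x; have := bM s y (r * Y x) e s12 d12; rewrite normrM (ger0_norm r0).
move=> /(ler_wpM2l (p0 x)); rewrite -{1}(ger0_norm (p0 x)) -normrM.
move=> h; apply: (le_trans (le_trans _ h)); rewrite le_eqVlt;
  apply/orP; left; apply/eqP; rewrite ?exprMn /g /c.
- by congr (`|_|); field.
- by ring.
Qed.

(** The errors of the single steps add up, because averaging is monotone and
    commutes with adding a constant. *)
Lemma iter_heat_walk (M : R) n k y :
  0 <= M -> lindeberg_bound M -> (1 < n)%N -> 0 < v -> (k <= n)%N ->
  let r := (Num.sqrt (v * n%:R))^-1 in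
  let e := M * (r ^+ 3 * \int[nu]_x (p x * `|Y x| ^+ 3) + n%:R^-1 ^+ 2) in
  let W := iter k (walk_step nu p (fun x => r * Y x)) (EFin \o heat 1) in
  (W y <= (heat (1 + k%:R / n%:R) y + k%:R * e)%:E /\
   (heat (1 + k%:R / n%:R) y)%:E <= W y + (k%:R * e)%:E)%E.
Proof.
move=> M0 bM n1 v0 + r e.
have n0 : 0 < n%:R :> R by rewrite ltr0n ltnW.
have r0 : 0 <= r by rewrite invr_ge0 sqrtr_ge0.
have r2v : r ^+ 2 * v = n%:R^-1.
  rewrite exprVn sqr_sqrtr; last by rewrite ltW// mulr_gt0.
  by field; rewrite !gt_eqF.
have e0 : 0 <= e.
  rewrite mulr_ge0// addr_ge0 ?sqr_ge0// mulr_ge0// ?exprn_ge0//.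
  by apply: Rintegral_ge0 => x _; rewrite mulr_ge0// exprn_ge0.
have mrY : measurable_fun setT (fun x => r * Y x) by exact: measurable_funM.
have mh (s : R) : 1 <= s -> measurable_fun setT (EFin \o heat s).
  move=> s1; apply/measurable_EFinP; apply: measurable_heat.
  exact: lt_le_trans ltr01 s1.
have h0 (s z : R) : (0 <= (EFin \o heat s) z)%E by rewrite lee_fin expR_ge0.
have step s z : 1 <= s <= 2 ->
    walk_step nu p (fun x => r * Y x) (EFin \o heat s) z =
    (\int[nu]_x (p x * heat s (z + r * Y x)))%:E.
  by move=> s12; rewrite -integral_EFin_Rintegral//; exact: integrable_heat.
elim: k y => [|k ih] y kn W; first by rewrite /W/= !mul0r !addr0.
pose s : R := 1 + k%:R / n%:R.
have s12 : 1 <= s <= 2.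
  have kn0 : 0 <= k%:R / n%:R :> R by rewrite divr_ge0.
  have kn1 : k%:R / n%:R <= 1 :> R by rewrite ler_pdivrMr// mul1r ler_nat ltnW.
  by apply/andP; split; [rewrite lerDl|exact: (lerD (lexx 1) kn1)].
have sS : 1 + k.+1%:R / n%:R = s + r ^+ 2 * v.
  by rewrite r2v -natr1 mulrDl mul1r addrA.
have n2 : 0 <= r ^+ 2 * v <= 2^-1.
  by rewrite r2v invr_ge0 (ltW n0)/= lef_pV2 ?posrE// ler_nat.
have := @heat_walk_step M _ y r bM s12 r0 n2.
rewrite -sS r2v -/e ler_distl => /andP[lo hi].
have s1 : 1 <= s by case/andP: s12.
have [mk k0] := iter_walk_step nu p0 mp mrY k (mh 1 (lexx _)) (h0 1).
have ke0 : 0 <= k%:R * e by rewrite mulr_ge0.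
have keS : k.+1%:R * e = k%:R * e + e by rewrite -natr1 mulrDl mul1r.
have mcst (c : R) : measurable_fun setT (fun _ : R => c%:E : \bar R).
  exact: measurable_cst.
rewrite {}/W iterS; split.
- apply: (@le_trans _ _ (walk_step nu p (fun x => r * Y x)
    (fun z => (EFin \o heat s) z + (k%:R * e)%:E)%E y)).
    apply: le_walk_step => //.
    + by apply: emeasurable_funD => //; exact: mh.
    + by move=> z; rewrite k0 /= -EFinD; have [] := ih z (ltnW kn).
  rewrite walk_stepD_cst//; last exact: mh.
  by rewrite step// -EFinD lee_fin keS [_ + e]addrC addrA lerD2r.
- apply: (@le_trans _ _ (walk_step nu p (fun x => (r * Y x)%R)
    (EFin \o heat s) y + e%:E)%E).
    by rewrite step// -EFinD lee_fin -lerBlDr.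
  rewrite keS EFinD addeA leeD2r// -walk_stepD_cst//.
  apply: le_walk_step => //; first exact: mh.
  + by apply: emeasurable_funD.
  + by move=> z; rewrite h0/=; have [_] := ih z (ltnW kn).
Qed.

(** This is the expectation of [expR (- Z ^+ 2 / 2)] for a standard
    Gaussian [Z]. *)
Lemma heat20 : heat 2 0 = (Num.sqrt 2)^-1 :> R.
Proof.
have -> : Num.sqrt 2 = expR (ln 2 / 2) :> R.
  rewrite -[X in Num.sqrt X]lnK ?posrE// [X in expR X]splitr expRD.
  by rewrite sqrtr_sqr ger0_norm ?expR_ge0.
by rewrite /heat expr0n/= oppr0 mul0r add0r expRN.
Qed.

(** The test function is the heat kernel at time 1, so that replacing the [n]
    increments one at a time by Gaussian ones of variance [1 / n] leads to the
    heat kernel at time 2.  The accumulated error is of order [1 / sqrt n]. *)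
Lemma gaussian_functional_clt (e : R) : 0 < v -> 0 < e ->
  \forall n \near \oo,
    (((Num.sqrt 2)^-1 - e)%:E <=
     \int[power_measure nu n]_s ((sample_density p s)%:E *
       (expR (- sample_sum Y s ^+ 2 / (2 * (v * n%:R))))%:E) <=
     ((Num.sqrt 2)^-1 + e)%:E)%E.
Proof.
have [M M0 bM] := @lindeberg_bound_exists R.
move=> v0 e0; set m3 := \int[nu]_x (p x * `|Y x| ^+ 3).
have m30 : 0 <= m3.
  by apply: Rintegral_ge0 => x _; rewrite mulr_ge0// exprn_ge0.
(* For [sqrt n >= C] the accumulated error is at most [e]. *)
pose C := M * (m3 / (v * Num.sqrt v) + 1) / e.
have sv0 : 0 < Num.sqrt v by rewrite sqrtr_gt0.
have C0 : 0 <= C.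
  rewrite divr_ge0 ?(ltW e0)// mulr_ge0// addr_ge0// divr_ge0//.
  by rewrite mulr_ge0// ltW.
near=> n.
have n1 : (1 < n)%N by near: n; exact: nbhs_infty_gt.
have n0 : 0 < n%:R :> R by rewrite ltr0n ltnW.
have sn0 : 0 < Num.sqrt n%:R :> R by rewrite sqrtr_gt0.
have snn : Num.sqrt n%:R ^+ 2 = n%:R :> R by rewrite sqr_sqrtr// ltW.
have sn1 : 1 <= Num.sqrt n%:R :> R.
  by rewrite -[leLHS]sqrtr1 ler_sqrt ?(ltW n0)// ler1n ltnW.
have Cn : C <= Num.sqrt n%:R.
  rewrite -[C]ger0_norm// -sqrtr_sqr ler_sqrt ?(ltW n0)//.
  by near: n; exact: nbhs_infty_ger.
have [] := iter_heat_walk 0 M0 bM n1 v0 (leqnn n).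
rewrite -/m3 divff ?gt_eqF// -(natrD _ 1 1) heat20.
set r := (Num.sqrt (v * n%:R))^-1; set E := n%:R * _ => hi lo.
have Ee : E <= e.
  have rE : r = (Num.sqrt v * Num.sqrt n%:R)^-1 by rewrite /r sqrtrM// ltW.
  have -> : E = M * (m3 / (v * Num.sqrt v) + (Num.sqrt n%:R)^-1) /
      Num.sqrt n%:R.
    have svv : Num.sqrt v ^+ 2 = v by rewrite sqr_sqrtr// ltW.
    rewrite /E rE; move: sv0 sn0 snn svv.
    set a := Num.sqrt v; set b := Num.sqrt n%:R => a0 b0 <- <-.
    by field; rewrite !gt_eqF.
  rewrite ler_pdivrMr//; apply: (le_trans _ (ler_wpM2l (ltW e0) Cn)).
  rewrite /C mulrCA divff ?gt_eqF// mulr1 ler_wpM2l// lerD2l.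
  by rewrite invf_le1.
have mg : measurable_fun setT (EFin \o heat (1 : R)).
  by apply/measurable_EFinP; exact: measurable_heat ltr01.
have mrY : measurable_fun setT (fun x => r * Y x) by exact: measurable_funM.
have g0 z : (0 <= (EFin \o heat (1 : R)) z)%E by rewrite lee_fin expR_ge0.
have intE : (\int[power_measure nu n]_s ((sample_density p s)%:E *
       (expR (- sample_sum Y s ^+ 2 / (2 * (v * n%:R))))%:E))%E =
    iter n (walk_step nu p (fun x => r * Y x)) (EFin \o heat 1) 0.
  rewrite -(integral_sample_sum nu p0 mp mrY _ _ mg g0).
  have [m ->] := power_measure_sigma_finite nu n.
  apply: eq_integral => s _; congr (_ * _%:E)%E.
  rewrite /heat ln1 mul0r subr0 add0r /sample_sum -mulr_sumr exprMn.
  rewrite exprVn sqr_sqrtr; last by rewrite mulr_ge0// ltW.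
  by congr expR; field; rewrite !gt_eqF.
rewrite intE; apply/andP; split.
  rewrite EFinB leeBlDr//; apply: (le_trans lo).
  by rewrite leeD2l// lee_fin.
by apply: (le_trans hi); rewrite lee_fin lerD2l.
Unshelve. all: by end_near.
Qed.

End gaussian_clt.

(** * Gaussian integrals *)

Section gaussian_integral.
Context {R : realType}.

(** Completing the square turns the integrand into a constant multiple of the
    normal density of mean [t0 + s / J] and variance [1 / J]. *)
Lemma integral_gaussian (t0 s J : R) : 0 < J ->
  (\int[lebesgue_measure]_t
     (expR ((t - t0) * s - J * (t - t0) ^+ 2 / 2))%:E =
   (Num.sqrt (2 * pi / J) * expR (s ^+ 2 / (2 * J)))%:E)%E.
Proof.
move=> J0; pose sigma := Num.sqrt J^-1; pose m := t0 + s / J.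
have s2 : sigma ^+ 2 = J^-1 by rewrite sqr_sqrtr// invr_ge0 ltW.
have sn0 : sigma != 0 by rewrite gt_eqF// sqrtr_gt0 invr_gt0.
have c0 : 0 <= Num.sqrt (2 * pi / J) * expR (s ^+ 2 / (2 * J)).
  by rewrite mulr_ge0 ?sqrtr_ge0 ?expR_ge0.
rewrite -[RHS]mule1 -(integral_normal_pdf m sigma).
rewrite -ge0_integralZl_EFin//; last 2 first.
- by move=> t _; rewrite lee_fin normal_pdf_ge0.
- by apply/measurable_EFinP; exact: measurable_normal_pdf.
apply: eq_integral => t _; rewrite -EFinM; congr (_%:E).
rewrite normal_pdfE// /normal_peak /normal_fun s2.
have -> : J^-1 * pi *+ 2 = 2 * pi / J by rewrite -mulr_natl; ring.
rewrite mulrACA divff ?mul1r; last first.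
  by rewrite gt_eqF// sqrtr_gt0 divr_gt0// mulr_gt0// pi_gt0.
rewrite -expRD; congr expR; rewrite /m -mulr_natl; field.
by rewrite gt_eqF.
Qed.

Lemma measurable_gaussian (t0 s J : R) : measurable_fun setT
  (fun t : R => (expR ((t - t0) * s - J * (t - t0) ^+ 2 / 2))%:E).
Proof.
apply/measurable_EFinP; apply: measurableT_comp => //.
have mt : measurable_fun setT (fun t : R => t - t0) by exact: measurable_funB.
apply: measurable_funB; first exact: measurable_funM.
by do 2 apply: measurable_funM => //; exact: measurable_funX.
Qed.

End gaussian_integral.

Section gauss_ratio.
Context {R : realType}.
Implicit Types (P I e N w : R).

Lemma sqrt_mul_expR (x y : R) : 0 <= x ->
  Num.sqrt (x * expR y) = Num.sqrt x * expR (y / 2).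
Proof.
move=> x0; rewrite sqrtrM//; congr (_ * _).
by rewrite [X in expR X]splitr expRD -expr2 sqrtr_sqr ger0_norm ?expR_ge0.
Qed.

(** A perturbation of order [e] of the curvature [I] changes a Gaussian integral
    only by a factor [1 + O(e)], uniformly for bounded [w]; here [w] stands for
    [s ^+ 2 / N] and [P] for [2 * pi]. *)
Lemma gauss_ratio_ub P I e N w :
  0 < P -> 0 < e -> e <= I / 8 -> 0 < N -> 0 <= w ->
  Num.sqrt (P / ((I - 4 * e) * N)) * expR (w / (2 * (I - 4 * e))) <=
  Num.sqrt (P / (I * N)) * expR (w / (2 * I)) *
  expR (e * (4 / I + 4 * w / I ^+ 2)).
Proof.
move=> p0 e0 eI N0 w0; have I0 : 0 < I by lra.
set J := I - 4 * e; have J0 : 0 < J by rewrite /J; lra.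
have JI : I / 2 <= J by rewrite /J; lra.
have PIN0 : 0 <= P / (I * N) by rewrite ltW// divr_gt0// mulr_gt0.
have -> : e * (4 / I + 4 * w / I ^+ 2) =
    8 * e / I / 2 + 4 * e * w / I ^+ 2 by field; rewrite gt_eqF.
rewrite [expR (8 * e / I / 2 + _)]expRD mulrACA -(sqrt_mul_expR _ PIN0).
apply: ler_pM; rewrite ?sqrtr_ge0 ?expR_ge0//.
  rewrite ler_sqrt; last by rewrite mulr_ge0 ?expR_ge0.
  have -> : P / (J * N) = P / (I * N) * (I / J).
    by field; rewrite !gt_eqF.
  rewrite ler_wpM2l//.
  apply: (le_trans _ (expR_ge1Dx _)); rewrite ler_pdivrMr//.
  rewrite (_ : (1 + _) * J = J + 8 * e * J / I); last by ring.
  rewrite -lerBlDl (_ : I - J = 4 * e); last by rewrite /J; ring.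
  by rewrite ler_pdivlMr//; nra.
rewrite -expRD ler_expR.
have -> : w / (2 * J) = w / (2 * I) + 2 * e * w / (I * J).
  by rewrite /J; field; rewrite -/J !gt_eqF.
rewrite lerD2l ler_pdivrMr ?mulr_gt0//.
rewrite (_ : _ / I ^+ 2 * _ = 4 * e * w * J / I); last by field; rewrite gt_eqF.
rewrite ler_pdivlMr//.
have ew : 0 <= e * w by rewrite mulr_ge0// ltW.
by nra.
Qed.

Lemma gauss_ratio_lb P I e N w : 0 < P -> 0 < e -> 0 < I -> 0 < N -> 0 <= w ->
  Num.sqrt (P / (I * N)) * expR (w / (2 * I)) *
  expR (- (e * (4 / I + 4 * w / I ^+ 2))) <=
  Num.sqrt (P / ((I + 4 * e) * N)) * expR (w / (2 * (I + 4 * e))).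
Proof.
move=> p0 e0 I0 N0 w0.
set J := I + 4 * e; have J0 : 0 < J by rewrite /J; lra.
have JI : I <= J by rewrite /J; lra.
have PIN0 : 0 <= P / (I * N) by rewrite ltW// divr_gt0// mulr_gt0.
have -> : - (e * (4 / I + 4 * w / I ^+ 2)) =
    - (8 * e / I) / 2 + - (4 * e * w / I ^+ 2) by field; rewrite gt_eqF.
rewrite expRD mulrACA -sqrt_mul_expR//.
apply: ler_pM; rewrite ?sqrtr_ge0 ?mulr_ge0 ?expR_ge0//.
  rewrite ler_sqrt; last by rewrite ltW// divr_gt0// mulr_gt0.
  have -> : P / (J * N) = P / (I * N) * (I / J).
    by field; rewrite !gt_eqF.
  rewrite ler_wpM2l//.
  rewrite expRN -[I / J]invf_div lef_pV2 ?posrE ?expR_gt0 ?divr_gt0//.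
  apply: (le_trans _ (expR_ge1Dx _)); rewrite ler_pdivrMr//.
  rewrite (_ : (1 + _) * I = I + 8 * e); last by field; rewrite gt_eqF.
  by rewrite /J; lra.
rewrite -expRD ler_expR.
have -> : w / (2 * I) = w / (2 * J) + 2 * e * w / (I * J).
  by rewrite /J; field; rewrite -/J !gt_eqF.
rewrite -addrA gerDl subr_le0 ler_pdivrMr ?mulr_gt0//.
rewrite (_ : _ / I ^+ 2 * _ = 4 * e * w * J / I); last by field; rewrite gt_eqF.
rewrite ler_pdivlMr//.
have ew : 0 <= e * w by rewrite mulr_ge0// ltW.
by nra.
Qed.

End gauss_ratio.

(** * Laplace's method for the posterior density *)

Section laplace.
Context {R : realType}.
Variables (Theta : set R) (h K prior : R -> R) (t0 I : R).
Hypothesis mTheta : measurable Theta.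
Hypothesis mh : measurable_fun Theta h.
Hypothesis mK : measurable_fun Theta K.
Hypothesis mprior : measurable_fun Theta prior.
Hypothesis prior_gt0 : forall t, Theta t -> 0 < prior t.
Hypothesis prior1 :
  (\int[lebesgue_measure]_(t in Theta) (prior t)%:E = 1)%E.
Hypothesis I0 : 0 < I.
Hypothesis Theta0 : Theta t0.
Hypothesis local : forall e : R, 0 < e -> exists2 de : R, 0 < de &
  forall t, `|t - t0| <= de -> [/\ Theta t,
    `|h t - (t - t0)| <= e * `|t - t0|,
    `|K t - I / 2 * (t - t0) ^+ 2| <= e * (t - t0) ^+ 2 &
    `|prior t - prior t0| <= e * prior t0].
Hypothesis far : forall de : R, 0 < de -> exists c : R, 0 < c /\
  forall t, Theta t -> de < `|t - t0| -> c <= `|h t| /\ c * `|h t| <= K t.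

(** This is the evidence divided by the likelihood at [t0], as a function of the
    sum [s] of the centred scores; [h] stands for the natural parameter and [K]
    for the cumulant function, both recentred at [t0]. *)
Definition tilted_mass n (s : R) : \bar R :=
  (\int[lebesgue_measure]_(t in Theta)
     (expR (h t * s - n%:R * K t) * prior t)%:E)%E.

(** This is what the tilted mass becomes when [h], [K], the prior and [Theta]
    are replaced by [t - t0], [I / 2 * (t - t0) ^+ 2], the constant 1 and the whole
    line. *)
Definition gauss_mass n (s : R) : R :=
  Num.sqrt (2 * pi / (I * n%:R)) * expR (s ^+ 2 / (2 * (I * n%:R))).

Let prior0 : 0 < prior t0. Proof. exact: prior_gt0. Qed.

Let pi2 : 0 < 2 * pi :> R. Proof. by rewrite mulr_gt0// pi_gt0. Qed.

Lemma measurable_tilted_integrand n s :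
  measurable_fun Theta (fun t => (expR (h t * s - n%:R * K t) * prior t)%:E).
Proof.
apply/measurable_EFinP; apply: measurable_funM => //.
apply: measurableT_comp => //; apply: measurable_funB.
  exact: measurable_funM.
exact: measurable_funM.
Qed.

Let int_ge0 n s t : Theta t ->
  (0 <= (expR (h t * s - n%:R * K t) * prior t)%:E)%E.
Proof. by move=> Tt; rewrite lee_fin mulr_ge0 ?expR_ge0// ltW// prior_gt0. Qed.

(** The cross term [`|t| * `|s|] is split by the arithmetic-geometric mean
    inequality into the two squares that the Gaussian exponent can absorb. *)
Lemma near_exponent (e N s t hh kk : R) : 0 <= e -> 0 < N ->
  `|hh - t| <= e * `|t| -> `|kk - I / 2 * t ^+ 2| <= e * t ^+ 2 ->
  t * s - (I + 4 * e) * N * t ^+ 2 / 2 - e * (s ^+ 2 / N) <=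
    hh * s - N * kk <=
  t * s - (I - 4 * e) * N * t ^+ 2 / 2 + e * (s ^+ 2 / N).
Proof.
move=> e0 N0 ht kt.
have amgm : `|t| * `|s| <= (N * t ^+ 2 + s ^+ 2 / N) / 2.
  have -> : (N * t ^+ 2 + s ^+ 2 / N) / 2 =
      (N * `|t| - `|s|) ^+ 2 / (2 * N) + `|t| * `|s|.
    rewrite -(real_normK (num_real t)) -(real_normK (num_real s)).
    by field; rewrite gt_eqF.
  by rewrite lerDr divr_ge0 ?sqr_ge0// mulr_ge0// ltW.
have w0 : 0 <= s ^+ 2 / N by rewrite divr_ge0 ?sqr_ge0// ltW.
have t20 := sqr_ge0 t.
have hs : `|(hh - t) * s| <= e * ((N * t ^+ 2 + s ^+ 2 / N) / 2).
  rewrite normrM; apply: le_trans (ler_wpM2l e0 amgm).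
  by rewrite mulrA ler_wpM2r.
have ks : `|N * (kk - I / 2 * t ^+ 2)| <= e * (N * t ^+ 2).
  by rewrite normrM (gtr0_norm N0) [leRHS]mulrCA ler_wpM2l// ltW.
move: hs ks; rewrite !ler_norml => /andP[h1 h2] /andP[k1 k2].
have Nt : 0 <= N * t ^+ 2 by rewrite mulr_ge0// ltW.
have eNt := mulr_ge0 e0 Nt; have ew := mulr_ge0 e0 w0.
rewrite (_ : (I + 4 * e) * N * t ^+ 2 / 2 =
  I / 2 * (N * t ^+ 2) + 2 * (e * (N * t ^+ 2))); last by field.
rewrite (_ : (I - 4 * e) * N * t ^+ 2 / 2 =
  I / 2 * (N * t ^+ 2) - 2 * (e * (N * t ^+ 2))); last by field.
by apply/andP; split; lra.
Qed.

(** Near [t0] the integrand is dominated by a Gaussian of curvature [I - 4 * e];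
    away from [t0] the lower bound on [K] makes it exponentially small relative
    to the prior, which is integrable. *)
Lemma tilted_mass_ub (e : R) : 0 < e -> 4 * e < I -> exists2 c : R, 0 < c &
  forall n (s : R), (0 < n)%N -> `|s| <= c * n%:R ->
  (tilted_mass n s <=
   ((1 + e) * prior t0 * expR (e * (s ^+ 2 / n%:R)) *
    (Num.sqrt (2 * pi / ((I - 4 * e) * n%:R)) *
     expR (s ^+ 2 / (2 * ((I - 4 * e) * n%:R)))) +
    expR (- (c ^+ 2 * n%:R)))%:E)%E.
Proof.
move=> e0 eI; have [de de0 loc] := local e0; have [c' [c0' farc]] := far de0.
pose c := c' / 2; have c0 : 0 < c by rewrite divr_gt0.
exists c => // n s n0 sc.
have N0 : 0 < n%:R :> R by rewrite ltr0n.
have J0 : 0 < (I - 4 * e) * n%:R by rewrite mulr_gt0// subr_gt0.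
set a := (1 + e) * prior t0 * expR (e * (s ^+ 2 / n%:R)).
have a0 : 0 <= a.
  by rewrite !mulr_ge0 ?expR_ge0// ?addr_ge0// ltW.
pose g t := expR ((t - t0) * s - (I - 4 * e) * n%:R * (t - t0) ^+ 2 / 2).
have mg D : measurable_fun D (EFin \o g).
  by apply: measurable_funTS; exact: measurable_gaussian.
have g0 t : (0 <= (g t)%:E)%E by rewrite lee_fin expR_ge0.
pose b := expR (- (c ^+ 2 * n%:R)).
apply: (@le_trans _ _ (\int[lebesgue_measure]_(t in Theta)
    (a%:E * (g t)%:E + b%:E * (prior t)%:E))%E).
  apply: ge0_le_integral => //.
  - exact: int_ge0.
  - exact: measurable_tilted_integrand.
  - apply: emeasurable_funD; apply: measurable_funeM; first exact: mg.
    by apply/measurable_EFinP.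
  move=> t Tt; rewrite -!EFinM -EFinD lee_fin.
  have pt := prior_gt0 Tt.
  have [tde|tde] := leP `|t - t0| de.
    have [_ ht kt] := loc t tde; rewrite ler_distl => /andP[_ pt'].
    have /andP[_ ub] := near_exponent s (ltW e0) N0 ht kt.
    apply: ler_wpDr; first by rewrite mulr_ge0 ?expR_ge0// ltW.
    have -> : a * g t =
        expR (e * (s ^+ 2 / n%:R)) * g t * ((1 + e) * prior t0).
      by rewrite /a; ring.
    rewrite ler_pM ?expR_ge0 ?(ltW pt)//; last by rewrite mulrDl mul1r.
    by rewrite /g -expRD ler_expR [_ + (_ - _ / _)]addrC.
  have [ch cK] := farc t Tt tde.
  apply: ler_wpDl; first by rewrite mulr_ge0 ?expR_ge0.
  rewrite ler_pM2r// ler_expR.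
  have hs : h t * s <= `|h t| * (c * n%:R).
    by apply: (le_trans (ler_norm _)); rewrite normrM ler_wpM2l.
  have Kn : c' * `|h t| * n%:R <= n%:R * K t.
    by rewrite [leRHS]mulrC ler_wpM2r// ltW.
  have cc : c ^+ 2 * n%:R <= c * `|h t| * n%:R.
    rewrite ler_pM2r// expr2 ler_pM2l//.
    by apply: le_trans ch; rewrite /c; lra.
  have e2 : c' = c + c by rewrite /c; field.
  rewrite e2 in Kn; lra.
rewrite ge0_integralD//; last 4 first.
- by move=> t _; rewrite mule_ge0// lee_fin.
- by apply: measurable_funeM; exact: mg.
- by move=> t Tt; rewrite mule_ge0 ?lee_fin ?expR_ge0// ltW// prior_gt0.
- by apply: measurable_funeM; apply/measurable_EFinP.
rewrite EFinD; apply: leeD.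
  rewrite ge0_integralZl_EFin//; last exact: mg.
  rewrite [leRHS]EFinM; apply: lee_wpmul2l; first by rewrite lee_fin.
  rewrite -(integral_gaussian t0)//; apply: ge0_subset_integral => //.
  exact: measurable_gaussian.
rewrite ge0_integralZl_EFin ?prior1 ?mule1 ?expR_ge0//.
  by move=> t Tt; rewrite lee_fin ltW// prior_gt0.
exact/measurable_EFinP.
Qed.

(** Near [t0] the integrand dominates a Gaussian of curvature [J = I + 4 * e].
    The part of that Gaussian away from [t0], which has no counterpart in the
    tilted mass, is at most [expR (- (c * n))] times a Gaussian of curvature
    [J / 4]. *)
Lemma tilted_mass_lb (e : R) : 0 < e -> e <= 1 -> exists2 c : R, 0 < c &
  forall n (s : R), (0 < n)%N -> `|s| <= c * n%:R ->
  (((1 - e) * prior t0 * expR (- (e * (s ^+ 2 / n%:R))) *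
    (Num.sqrt (2 * pi / ((I + 4 * e) * n%:R)) *
     expR (s ^+ 2 / (2 * ((I + 4 * e) * n%:R)))))%:E <=
   tilted_mass n s +
   (prior t0 * expR (- (c * n%:R)) *
    Num.sqrt (2 * pi / ((I + 4 * e) * n%:R / 4)))%:E)%E.
Proof.
move=> e0 e1; have [de de0 loc] := local e0.
pose J := I + 4 * e; have J0 : 0 < J by rewrite addr_gt0// mulr_gt0.
pose c := Num.min (J * de / 4) (J * de ^+ 2 / 8).
have c0 : 0 < c by rewrite lt_min !divr_gt0// mulr_gt0// exprn_gt0.
have [c1 c2] : c <= J * de / 4 /\ c <= J * de ^+ 2 / 8.
  by rewrite !ge_min !lexx orbT.
exists c => // n s n0 sc; rewrite -/J.
have N0 : 0 < n%:R :> R by rewrite ltr0n.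
have JN0 : 0 < J * n%:R by rewrite mulr_gt0.
set a := (1 - e) * prior t0 * expR (- (e * (s ^+ 2 / n%:R))).
have e10 : 0 <= 1 - e by rewrite subr_ge0.
have a0 : 0 <= a by rewrite !mulr_ge0 ?expR_ge0// ltW.
have ap : a <= prior t0.
  rewrite /a mulrAC -[leRHS]mul1r ler_wpM2r ?(ltW prior0)//.
  apply: (@le_trans _ _ (1 * 1)); last by rewrite mulr1.
  rewrite ler_pM ?expR_ge0//; first lra.
  rewrite -expR0 ler_expR oppr_le0 mulr_ge0 ?(ltW e0)//.
  by rewrite divr_ge0 ?sqr_ge0// ltW.
pose g s' J' t := expR ((t - t0) * s' - J' * (t - t0) ^+ 2 / 2).
have mg s' J' D : measurable_fun D (EFin \o g s' J').
  by apply: measurable_funTS; exact: measurable_gaussian.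
have g0 s' J' t : (0 <= (g s' J' t)%:E)%E by rewrite lee_fin expR_ge0.
pose f t := (expR (h t * s - n%:R * K t) * prior t)%:E.
have f0 t : (0 <= (f \_ Theta) t)%E.
  by rewrite patchE; case: ifPn => // /[!inE] tT; exact: int_ge0.
have mf : measurable_fun setT (f \_ Theta).
  by apply/(measurable_restrictT f mTheta); exact: measurable_tilted_integrand.
pose b := prior t0 * expR (- (c * n%:R)).
have b0 : 0 <= b by rewrite mulr_ge0 ?expR_ge0// ltW.
rewrite [leLHS]EFinM -[X in (_ * X)%E](integral_gaussian t0)//.
rewrite -ge0_integralZl_EFin//; last first.
  exact: measurable_gaussian.
apply: (@le_trans _ _ (\int[lebesgue_measure]_t
    ((f \_ Theta) t + b%:E * (g 0 (J * n%:R / 4) t)%:E))%E); last first.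
  rewrite ge0_integralD//; last 2 first.
  - by move=> t _; rewrite mule_ge0// lee_fin.
  - by apply: measurable_funeM; exact: mg.
  rewrite -integral_mkcond leeD2l// ge0_integralZl_EFin//; last exact: mg.
  rewrite [leRHS]EFinM; apply: lee_wpmul2l; first by rewrite lee_fin.
  rewrite /g integral_gaussian ?divr_gt0//.
  by rewrite expr0n/= mul0r expR0 mulr1.
apply: ge0_le_integral => //.
- by move=> t _; rewrite mule_ge0// lee_fin.
- by apply: measurable_funeM; exact: mg.
- by apply: emeasurable_funD => //; apply: measurable_funeM; exact: mg.
move=> t _; have [tde|tde] := leP `|t - t0| de.
  have [Tt ht kt] := loc t tde; rewrite ler_distl => /andP[pt' _].
  have /andP[lb _] := near_exponent s (ltW e0) N0 ht kt.
  apply: lee_paddr; first by rewrite mule_ge0// lee_fin.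
  rewrite patchE mem_set//= -EFinM lee_fin.
  have -> : a * g s (J * n%:R) t =
      expR (- (e * (s ^+ 2 / n%:R))) * g s (J * n%:R) t * ((1 - e) * prior t0).
    by rewrite /a; ring.
  rewrite ler_pM ?mulr_ge0 ?expR_ge0 ?(ltW prior0)//.
    by rewrite /g -expRD ler_expR [_ + (_ - _ / _)]addrC.
  by rewrite mulrBl mul1r.
apply: lee_paddl => //; rewrite -!EFinM lee_fin /b -[leRHS]mulrA.
apply: ler_pM => //.
rewrite /g -expRD ler_expR mulr0 sub0r.
have ts : (t - t0) * s <= `|t - t0| * (c * n%:R).
  by apply: (le_trans (ler_norm _)); rewrite normrM ler_wpM2l.
rewrite -(real_normK (num_real (t - t0))); set r := `|t - t0| in tde ts *.
have r0 : 0 < r by exact: lt_trans tde.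
have A1 : r * (c * n%:R) <= J * n%:R * r ^+ 2 / 4.
  rewrite (_ : _ / 4 = r * (J * r / 4 * n%:R)); last by field.
  rewrite ler_pM2l// ler_pM2r//; apply: (le_trans c1).
  by rewrite ler_pM2r// ler_pM2l// ltW.
have A2 : c * n%:R <= J * n%:R * r ^+ 2 / 8.
  rewrite (_ : _ / 8 = J * r ^+ 2 / 8 * n%:R); last by field.
  rewrite ler_pM2r//; apply: (le_trans c2).
  by rewrite ler_pM2r// ler_pM2l// ler_sqr ?nnegrE ltW.
lra.
Qed.

Lemma gauss_mass_gt0 n s : (0 < n)%N -> 0 < gauss_mass n s.
Proof.
move=> n0; rewrite mulr_gt0 ?expR_gt0// sqrtr_gt0 divr_gt0// mulr_gt0//.
by rewrite ltr0n.
Qed.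

Lemma gauss_massE n s : (0 < n)%N ->
  gauss_mass n s = Num.sqrt (2 * pi / I) / Num.sqrt n%:R *
    expR (s ^+ 2 / (2 * (I * n%:R))).
Proof.
move=> n0; have N0 : 0 < n%:R :> R by rewrite ltr0n.
rewrite /gauss_mass; congr (_ * _).
rewrite -sqrtrV ?ltW// -sqrtrM ?divr_ge0 ?(ltW pi2) ?ltW//.
by rewrite invfM mulrA.
Qed.

Lemma gauss_mass_ge n s : (0 < n)%N ->
  Num.sqrt (2 * pi / I) / Num.sqrt n%:R <= gauss_mass n s.
Proof.
move=> n0; have N0 : 0 < n%:R :> R by rewrite ltr0n.
rewrite gauss_massE// ler_peMr ?divr_ge0 ?sqrtr_ge0// -[leLHS]expR0 ler_expR.
by apply: divr_ge0; rewrite ?sqr_ge0// ltW// !mulr_gt0.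
Qed.

Lemma expRN_le (x : R) : 0 < x -> expR (- x) <= x^-1.
Proof.
move=> x0; rewrite expRN lef_pV2 ?posrE ?expR_gt0//.
by apply: le_trans (expR_ge1Dx x); rewrite lerDr.
Qed.

(** On the central scale [`|s| <= L * sqrt n] the quotient [s ^+ 2 / n] stays
    bounded, so that the perturbation [e] of the curvature can be chosen once
    for all [s]. *)
Lemma laplace_compact (L k : R) : 0 < L -> 0 < k -> k <= 1 ->
  \forall n \near \oo, forall s, `|s| <= L * Num.sqrt n%:R ->
    (((1 - k) * (prior t0 * gauss_mass n s))%:E <= tilted_mass n s <=
     ((1 + k) * (prior t0 * gauss_mass n s))%:E)%E.
Proof.
move=> L0 k0 k1.
(* [C] bounds all coefficients of [e] in the exponents when [w <= L ^+ 2]. *)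
pose C : R := 1 + (L ^+ 2 + 4 / I + 4 * L ^+ 2 / I ^+ 2).
have C1 : 1 <= C.
  by rewrite /C lerDl !addr_ge0// ?divr_ge0 ?mulr_ge0 ?exprn_ge0 ?ltW.
have C0 : 0 < C by lra.
pose e : R := Num.min (I / 8) (k / (4 * (C + C))).
have e0 : 0 < e by rewrite lt_min !divr_gt0// mulr_gt0// addr_gt0.
have eI : e <= I / 8 by rewrite ge_min lexx.
have eC : e * C <= k / 8.
  have : e <= k / (4 * (C + C)) by rewrite ge_min lexx orbT.
  rewrite ler_pdivlMr; last by rewrite mulr_gt0// addr_gt0.
  lra.
have e8 : e <= k / 8 by apply: le_trans eC; rewrite ler_peMr// ltW.
have e4 : 4 * e < I by lra.
have e1 : e <= 1 by lra.
have [c1 c10 ub] := tilted_mass_ub e0 e4.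
have [c2 c20 lb] := tilted_mass_lb e0 e1.
pose S0 := Num.sqrt (2 * pi / I).
have S00 : 0 < S0 by rewrite sqrtr_gt0 divr_gt0.
(* Beyond the thresholds [m1] and [m2] the exponentially small terms are at most
   [e] times the main one. *)
pose m1 := (c1 ^+ 2 * (e * (prior t0 * S0)))^-1.
have m10 : 0 < m1.
  by rewrite invr_gt0 mulr_gt0 ?exprn_gt0// mulr_gt0// mulr_gt0.
pose m2 := 2 / (c2 * e).
near=> n => s sL.
have n0 : (0 < n)%N by near: n; exact: nbhs_infty_gt.
have N0 : 0 < n%:R :> R by rewrite ltr0n.
have q0 : 0 < Num.sqrt n%:R :> R by rewrite sqrtr_gt0.
have qq : Num.sqrt n%:R ^+ 2 = n%:R :> R by rewrite sqr_sqrtr// ltW.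
have qle x : 0 <= x -> x ^+ 2 <= n%:R -> x <= Num.sqrt n%:R.
  by move=> x0 xn; rewrite -[x]ger0_norm// -sqrtr_sqr ler_sqrt// ltW.
have qL c : 0 < c -> L / c <= Num.sqrt n%:R -> `|s| <= c * n%:R.
  move=> c0; rewrite ler_pdivrMr// => Lc; apply: (le_trans sL).
  by rewrite -[in leRHS]qq expr2 mulrA ler_pM2r// mulrC.
have s1 : `|s| <= c1 * n%:R.
  apply: qL => //; apply: qle; first by rewrite divr_ge0// ltW.
  by near: n; exact: nbhs_infty_ger.
have s2 : `|s| <= c2 * n%:R.
  apply: qL => //; apply: qle; first by rewrite divr_ge0// ltW.
  by near: n; exact: nbhs_infty_ger.
pose w := s ^+ 2 / n%:R.
have w0 : 0 <= w by rewrite divr_ge0 ?sqr_ge0// ltW.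
have wL : w <= L ^+ 2.
  rewrite ler_pdivrMr// -qq -exprMn -(real_normK (num_real s)).
  by rewrite ler_sqr// nnegrE ?mulr_ge0// ltW.
have g0 := gauss_mass_gt0 s n0.
set G := prior t0 * gauss_mass n s.
have G0 : 0 < G by rewrite mulr_gt0.
have sw J : 0 < J -> s ^+ 2 / (2 * (J * n%:R)) = w / (2 * J).
  by move=> J0; rewrite /w; field; rewrite !gt_eqF.
have gE : gauss_mass n s = Num.sqrt (2 * pi / (I * n%:R)) * expR (w / (2 * I)).
  by rewrite /gauss_mass sw.
have ewC : e * w + e * (4 / I + 4 * w / I ^+ 2) + e <= e * C.
  rewrite -!mulrDr -[X in _ + X]mulr1 -mulrDr ler_pM2l// /C.
  have : 4 * w / I ^+ 2 <= 4 * L ^+ 2 / I ^+ 2.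
    by rewrite ler_pM2r ?invr_gt0 ?exprn_gt0// ler_pM2l.
  lra.
apply/andP; split; last first.
  apply: (le_trans (ub n s n0 s1)); rewrite lee_fin.
  have J0 : 0 < I - 4 * e by lra.
  rewrite sw// -/w.
  have r := gauss_ratio_ub pi2 e0 eI N0 w0; rewrite -gE in r.
  have A : (1 + e) * prior t0 * expR (e * w) *
      (Num.sqrt (2 * pi / ((I - 4 * e) * n%:R)) * expR (w / (2 * (I - 4 * e))))
      <= G * expR (e * C).
    apply: (@le_trans _ _ ((1 + e) * prior t0 * expR (e * w) *
      (gauss_mass n s * expR (e * (4 / I + 4 * w / I ^+ 2))))).
      rewrite ler_wpM2l// mulr_ge0 ?expR_ge0// mulr_ge0 ?(ltW prior0)//.
      by rewrite addr_ge0// ltW.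
    rewrite (_ : _ * _ = G * (expR (e * w + e * (4 / I + 4 * w / I ^+ 2)) *
      (1 + e))); last by rewrite expRD /G; ring.
    rewrite ler_pM2l//.
    apply: (@le_trans _ _ (expR (e * w + e * (4 / I + 4 * w / I ^+ 2)) *
      expR e)); last by rewrite -expRD ler_expR.
    by rewrite ler_wpM2l ?expR_ge0// expR_ge1Dx.
  have B : expR (- (c1 ^+ 2 * n%:R)) <= e * G.
    apply: (le_trans (expRN_le _)); first by rewrite mulr_gt0// exprn_gt0.
    apply: (@le_trans _ _ (e * (prior t0 * (S0 / Num.sqrt n%:R)))); last first.
      by rewrite ler_pM2l// ler_pM2l// gauss_mass_ge.
    have qm : m1 <= Num.sqrt n%:R.
      by apply: qle; [exact: ltW|near: n; exact: nbhs_infty_ger].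
    have -> : e * (prior t0 * (S0 / Num.sqrt n%:R)) =
        e * (prior t0 * S0) * Num.sqrt n%:R / n%:R.
      move: q0 qq; set q := Num.sqrt n%:R => q0 <-.
      by field; rewrite gt_eqF.
    rewrite invfM ler_pM2r ?invr_gt0//.
    move: qm; rewrite /m1 invfM ler_pdivrMr; last by rewrite !mulr_gt0.
    by rewrite mulrC.
  apply: (le_trans (lerD A B)); rewrite mulrC -mulrDl ler_pM2r//.
  have ex : expR (e * C) <= 1 + 2 * (e * C).
    have eC0 : 0 <= e * C by rewrite mulr_ge0// ltW.
    have := expR_ge1Dx (- (e * C)); rewrite expRN => h1.
    have E0 : 0 < expR (e * C) by exact: expR_gt0.
    have h2 : (1 - e * C) * expR (e * C) <= 1 by rewrite -ler_pdivlMr ?div1r.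
    set E := expR (e * C) in h1 h2 E0 *; set x := e * C in eC eC0 h1 h2 *.
    nra.
  lra.
have r := gauss_ratio_lb pi2 e0 I0 N0 w0; rewrite -gE in r.
have J0 : 0 < I + 4 * e by lra.
have := lb n s n0 s2; rewrite sw// -/w.
have B : prior t0 * expR (- (c2 * n%:R)) *
    Num.sqrt (2 * pi / ((I + 4 * e) * n%:R / 4)) <= e * G.
  have sq : Num.sqrt (2 * pi / ((I + 4 * e) * n%:R / 4)) <= 2 * gauss_mass n s.
    apply: (@le_trans _ _ (2 * Num.sqrt (2 * pi / (I * n%:R)))); last first.
      rewrite ler_pM2l// gE ler_peMr ?sqrtr_ge0// -[leLHS]expR0 ler_expR.
      by rewrite divr_ge0// mulr_ge0// ltW.
    rewrite -[X in X * Num.sqrt _](@ger0_norm R 2)// -sqrtr_sqr.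
    rewrite -sqrtrM ?sqr_ge0//.
    rewrite ler_sqrt; last first.
      by rewrite mulr_ge0 ?sqr_ge0// divr_ge0 ?(ltW pi2)// mulr_ge0 ?ltW.
    have -> : 2 * pi / ((I + 4 * e) * n%:R / 4) =
       2 ^+ 2 * (2 * pi / ((I + 4 * e) * n%:R)).
      by field; rewrite !gt_eqF.
    rewrite ler_pM2l ?exprn_gt0// ler_pM2l// lef_pV2 ?posrE ?mulr_gt0//.
    by rewrite ler_pM2r//; lra.
  have ex : expR (- (c2 * n%:R)) * 2 <= e.
    rewrite -ler_pdivlMr//; apply: (le_trans (expRN_le _)).
      by rewrite mulr_gt0.
    have : m2 <= n%:R by near: n; exact: nbhs_infty_ger.
    rewrite /m2 ler_pdivrMr ?mulr_gt0// => mn.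
    rewrite -div1r ler_pdivrMr ?mulr_gt0//; lra.
  have -> : e * G = prior t0 * (e * gauss_mass n s) by rewrite /G; ring.
  rewrite -mulrA ler_pM2l//.
  apply: (@le_trans _ _ (expR (- (c2 * n%:R)) * (2 * gauss_mass n s))).
    by rewrite ler_wpM2l ?expR_ge0.
  by rewrite mulrA ler_pM2r.
have A : G * (1 - 2 * e * C) <= (1 - e) * prior t0 * expR (- (e * w)) *
    (Num.sqrt (2 * pi / ((I + 4 * e) * n%:R)) * expR (w / (2 * (I + 4 * e)))).
  have e10 : 0 <= 1 - e by lra.
  apply: (@le_trans _ _ ((1 - e) * prior t0 * expR (- (e * w)) *
    (gauss_mass n s * expR (- (e * (4 / I + 4 * w / I ^+ 2)))))); last first.
    by rewrite ler_wpM2l// mulr_ge0 ?expR_ge0// mulr_ge0 ?(ltW prior0).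
  rewrite [leRHS](_ : _ = G * ((1 - e) *
    expR (- (e * w) + - (e * (4 / I + 4 * w / I ^+ 2))))); last first.
    by rewrite expRD /G; ring.
  rewrite ler_pM2l//.
  apply: (@le_trans _ _ ((1 - e) * (1 - e * C))).
    have := mulr_gt0 e0 C0; set x := e * C; rewrite -mulrA -/x => x0.
    have eCx : e <= x by rewrite /x ler_peMr// ltW.
    nra.
  rewrite ler_wpM2l// -opprD; apply: (le_trans _ (expR_ge1Dx _)).
  by rewrite lerD2l lerN2; lra.
move=> lbn.
have {lbn} := le_trans _ (le_trans lbn (leeD2l (tilted_mass n s) _)).
move=> /(_ (G * (1 - 2 * e * C))%:E (e * G)%:E); rewrite !lee_fin => /(_ A B).
rewrite -leeBlDr// -EFinB; apply: le_trans; rewrite lee_fin.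
rewrite [leRHS](_ : _ = (1 - (2 * (e * C) + e)) * G); last by ring.
rewrite ler_pM2r//; lra.
Unshelve. all: by end_near.
Qed.

(** Off the central scale a crude bound suffices: the parameters at distance
    between [1 / sqrt n] and [2 / sqrt n] from [t0], on the side of [s], already
    carry a mass that is exponentially large in [`|s| / sqrt n]. *)
Lemma tilted_mass_tail : \forall n \near \oo, forall s,
  ((prior t0 / 2 * expR (`|s| / (2 * Num.sqrt n%:R) - 2 * (I + 1)) /
    Num.sqrt n%:R)%:E <= tilted_mass n s)%E.
Proof.
have half0 : 0 < 2^-1 :> R by rewrite invr_gt0.
have [de de0 loc] := local half0.
near=> n => s.
have n0 : (0 < n)%N by near: n; exact: nbhs_infty_gt.
have N0 : 0 < n%:R :> R by rewrite ltr0n.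
pose r : R := (Num.sqrt n%:R)^-1.
have q0 : 0 < Num.sqrt n%:R :> R by rewrite sqrtr_gt0.
have r0 : 0 < r by rewrite invr_gt0.
have r2 : r ^+ 2 * n%:R = 1.
  by rewrite exprVn sqr_sqrtr ?(ltW N0)// mulVf// gt_eqF.
have r2de : 2 * r <= de.
  rewrite /r ler_pdivrMr// mulrC -ler_pdivrMr//.
  have d0 : 0 <= 2 / de by rewrite divr_ge0// ltW.
  rewrite -(ger0_norm d0) -sqrtr_sqr ler_sqrt ?(ltW N0)//.
  by near: n; exact: nbhs_infty_ger.
have [a aP] : exists a, forall t, a <= t <= a + r ->
    r <= `|t - t0| <= 2 * r /\ 0 <= (t - t0) * s.
  have [s0|s0] := leP 0 s.
    exists (t0 + r) => t /andP[at1 at2]; have tt : 0 <= t - t0 by lra.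
    by rewrite ger0_norm// mulr_ge0//; split => //; lra.
  exists (t0 - 2 * r) => t /andP[at1 at2]; have tt : t - t0 <= 0 by lra.
  by rewrite ler0_norm// mulr_le0 ?(ltW s0)//; split => //; lra.
set c := prior t0 / 2 * expR _.
have c0 : 0 <= c by rewrite mulr_ge0 ?expR_ge0// divr_ge0// ltW.
have key t : a <= t <= a + r -> Theta t /\
    c <= expR (h t * s - n%:R * K t) * prior t.
  move=> /aP[/andP[rt tr] ts0].
  have [Tt ht kt pt] := loc t (le_trans tr r2de); split => //.
  rewrite [leRHS]mulrC; apply: ler_pM; rewrite ?expR_ge0//.
  - by rewrite divr_ge0// ltW.
  - by move: pt; rewrite ler_distl => /andP[+ _]; lra.
  rewrite ler_expR; apply: lerB.
    have h1 : `|(h t - (t - t0)) * s| <= 2^-1 * ((t - t0) * s).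
      rewrite normrM -(ger0_norm ts0) normrM mulrA.
      by rewrite ler_wpM2r.
    have h2 : `|s| / (2 * Num.sqrt n%:R) <= 2^-1 * ((t - t0) * s).
      rewrite -(ger0_norm ts0) normrM invfM -/r mulrCA ler_pM2l//.
      by rewrite [leRHS]mulrC ler_wpM2l.
    move: h1; rewrite ler_norml => /andP[+ _]; lra.
  have tt : (t - t0) ^+ 2 * n%:R <= 4.
    rewrite -(real_normK (num_real _)).
    have : `|t - t0| ^+ 2 <= (2 * r) ^+ 2.
      by rewrite ler_sqr// nnegrE// mulr_ge0// ltW.
    rewrite exprMn => /(ler_wpM2r (ltW N0)) /le_trans; apply.
    by rewrite -mulrA r2 mulr1 -natrX.
  move: kt; rewrite ler_norml => /andP[_].
  rewrite lerBlDr -mulrDl => kt'.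
  apply: (@le_trans _ _ (n%:R * ((2^-1 + I / 2) * (t - t0) ^+ 2))).
    by rewrite ler_pM2l.
  rewrite [leLHS](_ : _ = (2^-1 + I / 2) * ((t - t0) ^+ 2 * n%:R)); last first.
    by ring.
  have I2 : 0 <= 2^-1 + I / 2 by rewrite addr_ge0// ?divr_ge0 ?invr_ge0// ltW.
  by apply: (le_trans (ler_wpM2l I2 tt)); lra.
have sub : `[a, a + r] `<=` Theta.
  by move=> t /=; rewrite in_itv/= => /key[].
apply: (@le_trans _ _ (\int[lebesgue_measure]_(t in `[a, (a + r)%R]) c%:E)%E).
  rewrite integral_cst//= lebesgue_measure_itv/= lte_fin ltrDl r0.
  by rewrite -EFinB addrAC subrr add0r -EFinM.
apply: (@le_trans _ _ (\int[lebesgue_measure]_(t in `[a, (a + r)%R])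
    (expR (h t * s - n%:R * K t) * prior t)%:E)%E).
  apply: ge0_le_integral => //.
  - by apply: measurable_funS mTheta sub _; exact: measurable_tilted_integrand.
  - by move=> t /=; rewrite in_itv/= => /key[_]; rewrite lee_fin.
apply: ge0_subset_integral => //; first exact: measurable_tilted_integrand.
by move=> t Tt; rewrite lee_fin mulr_ge0 ?expR_ge0// ltW// prior_gt0.
Unshelve. all: by end_near.
Qed.

(** The quotient is the posterior density at [t0] given a sample whose centred
    scores add up to [s].  On the central scale the tilted mass is known up to a
    factor close to 1; elsewhere both sides are small compared to [sqrt n]. *)
Lemma posterior_profile (e : R) : 0 < e ->
  \forall n \near \oo, forall s,
    (((gauss_mass n s)^-1 - e * Num.sqrt n%:R)%:E <=
     (prior t0)%:E / tilted_mass n s <=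
     ((gauss_mass n s)^-1 + e * Num.sqrt n%:R)%:E)%E.
Proof.
move=> e0; pose S0 := Num.sqrt (2 * pi / I).
have S00 : 0 < S0 by rewrite sqrtr_gt0 divr_gt0.
pose k := Num.min 2^-1 (e * S0 / 2).
have k0 : 0 < k by rewrite lt_min invr_gt0 ltr0n/= divr_gt0// mulr_gt0.
have k2 : k <= 2^-1 by rewrite ge_min lexx.
have ke : k <= e * S0 / 2 by rewrite ge_min lexx orbT.
pose E := expR (2 * (I + 1)); have E0 : 0 < E by exact: expR_gt0.
(* [L] is so large that off the central scale both the posterior density and its
   Gaussian profile are below [e * sqrt n]. *)
pose L := 1 + (4 * E / e + 2 * I / (S0 * e)).
have LE : 4 * E / e <= L.
  rewrite /L addrCA lerDl addr_ge0// divr_ge0// ?mulr_ge0// ltW//.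
have LS : 2 * I / (S0 * e) <= L.
  rewrite /L addrA lerDr addr_ge0// divr_ge0// ?mulr_ge0// ltW//.
have L1 : 1 <= L.
  by rewrite /L lerDl addr_ge0// divr_ge0// ?mulr_ge0// ltW.
have L0 : 0 < L by lra.
have k1 : k <= 1 by lra.
near=> n => s.
have n0 : (0 < n)%N by near: n; exact: nbhs_infty_gt.
have N0 : 0 < n%:R :> R by rewrite ltr0n.
have q0 : 0 < Num.sqrt n%:R :> R by rewrite sqrtr_gt0.
have g0 := gauss_mass_gt0 s n0.
have gge := gauss_mass_ge s n0.
have gV : (gauss_mass n s)^-1 <= Num.sqrt n%:R / S0.
  by rewrite -invf_div lef_pV2 ?posrE// divr_gt0.
have [sL|sL] := leP `|s| (L * Num.sqrt n%:R).
  have : forall s, `|s| <= L * Num.sqrt n%:R ->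
    (((1 - k) * (prior t0 * gauss_mass n s))%:E <= tilted_mass n s <=
     ((1 + k) * (prior t0 * gauss_mass n s))%:E)%E.
    by near: n; exact: laplace_compact.
  move=> /(_ s sL) /andP[lo hi].
  set G := prior t0 * gauss_mass n s in lo hi *.
  have G0 : 0 < G by rewrite mulr_gt0.
  have lo0 : 0 < (1 - k) * G by rewrite mulr_gt0//; lra.
  have hi0 : 0 < (1 + k) * G by rewrite mulr_gt0//; lra.
  have m0 : (0 <= tilted_mass n s)%E by apply: le_trans lo; rewrite lee_fin ltW.
  have kq : 2 * k * (gauss_mass n s)^-1 <= e * Num.sqrt n%:R.
    apply: (@le_trans _ _ (e * S0 * (Num.sqrt n%:R / S0))).
      apply: ler_pM => //; first by rewrite mulr_ge0// ltW.
        by rewrite invr_ge0 ltW.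
      lra.
    by rewrite [leLHS](_ : _ = e * Num.sqrt n%:R)//; field; rewrite gt_eqF.
  set g := (gauss_mass n s)^-1 in kq *.
  have gg : 0 < g by rewrite invr_gt0.
  have pG : prior t0 / G = g by rewrite /G invfM mulrA divff ?gt_eqF// mul1r.
  apply/andP; split.
    apply: (@le_trans _ _ ((prior t0)%:E / ((1 + k) * G)%:E)%E); last first.
      apply: lee_wpmul2l; first by rewrite lee_fin ltW.
      by rewrite lee_pV2 ?inE//= lee_fin ltW.
    rewrite inver gt_eqF// -EFinM lee_fin invfM mulrCA pG.
    rewrite ler_pdivlMl; last lra.
    have := mulr_ge0 (ltW k0) (ltW (mulr_gt0 e0 q0)); nra.
  apply: (@le_trans _ _ ((prior t0)%:E / ((1 - k) * G)%:E)%E).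
    apply: lee_wpmul2l; first by rewrite lee_fin ltW.
    by rewrite lee_pV2 ?inE//= lee_fin ltW.
  rewrite inver gt_eqF// -EFinM lee_fin invfM mulrCA pG.
  apply: (@le_trans _ _ (g + 2 * k * g)); last by rewrite lerD2l.
  rewrite ler_pdivrMl; last lra.
  have k20 : 0 <= 1 - 2 * k by lra.
  by have := mulr_ge0 (mulr_ge0 (ltW k0) (ltW gg)) k20; lra.
have : forall s,
  ((prior t0 / 2 * expR (`|s| / (2 * Num.sqrt n%:R) - 2 * (I + 1)) /
    Num.sqrt n%:R)%:E <= tilted_mass n s)%E by near: n; exact: tilted_mass_tail.
move=> /(_ s); set lo := (X in (X%:E <= _)%E) => lom.
have lo0 : 0 < lo by rewrite divr_gt0// mulr_gt0 ?expR_gt0// divr_gt0.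
have m0 : (0 <= tilted_mass n s)%E by apply: le_trans lom; rewrite lee_fin ltW.
have gp : 0 <= (gauss_mass n s)^-1 by rewrite invr_ge0 ltW.
apply/andP; split.
  apply: (@le_trans _ _ 0%E); last by rewrite mule_ge0 ?inve_ge0// lee_fin ltW.
  rewrite lee_fin subr_le0.
  pose x := s ^+ 2 / (2 * (I * n%:R)).
  have xL : L / (2 * I) <= x.
    rewrite /x (_ : s ^+ 2 / _ = s ^+ 2 / n%:R / (2 * I)); last first.
      by field; rewrite !gt_eqF.
    rewrite ler_pM2r ?invr_gt0 ?mulr_gt0// ler_pdivlMr//.
    rewrite -(real_normK (num_real s)).
    apply: (@le_trans _ _ ((L * Num.sqrt n%:R) ^+ 2)).
      rewrite exprMn sqr_sqrtr ?(ltW N0)// ler_pM2r// expr2 ler_peMl//.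
      exact: ltW.
    have Lq0 : 0 <= L * Num.sqrt n%:R by rewrite mulr_ge0// ltW.
    by rewrite ler_sqr ?nnegrE// ltW.
  have x0 : 0 < x by apply: lt_le_trans xL; rewrite divr_gt0// mulr_gt0.
  have gx : (gauss_mass n s)^-1 = Num.sqrt n%:R / S0 * expR (- x).
    by rewrite gauss_massE// -/x invfM invf_div -expRN.
  have eS : 0 < S0 * e by rewrite mulr_gt0.
  have xb : expR (- x) <= S0 * e.
    apply: (le_trans (expRN_le x0)); rewrite invf_ple ?posrE//.
    apply: le_trans xL; rewrite ler_pdivlMr ?mulr_gt0//.
    by rewrite mulrC.
  have -> : e * Num.sqrt n%:R = Num.sqrt n%:R / S0 * (S0 * e).
    by field; rewrite gt_eqF.
  by rewrite gx ler_pM2l// divr_gt0.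
apply: (@le_trans _ _ ((prior t0)%:E / lo%:E)%E).
  apply: lee_wpmul2l; first by rewrite lee_fin ltW.
  by rewrite lee_pV2 ?inE//= lee_fin ltW.
rewrite inver gt_eqF// -EFinM lee_fin; apply: ler_wpDl => //.
pose y := `|s| / (2 * Num.sqrt n%:R).
have yL : L / 2 <= y.
  rewrite /y invfM mulrCA [L / 2]mulrC ler_pM2l ?invr_gt0//.
  by rewrite ler_pdivlMr// ltW.
have y0 : 0 < y by apply: lt_le_trans yL; rewrite divr_gt0.
have -> : prior t0 / lo = 2 * E * expR (- y) * Num.sqrt n%:R.
  rewrite /lo -/y expRD expRN [expR (- y)]expRN -/E.
  by field; rewrite !gt_eqF// expR_gt0.
rewrite ler_pM2r//; apply: (@le_trans _ _ (2 * E * y^-1)).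
  by rewrite ler_pM2l ?mulr_gt0// expRN_le.
rewrite ler_pdivrMr//; apply: (@le_trans _ _ (e * (L / 2))); last first.
  by rewrite ler_pM2l.
by move: LE; rewrite ler_pdivrMr//; lra.
Unshelve. all: by end_near.
Qed.

Lemma measurable_tilted_mass n : measurable_fun setT (tilted_mass n).
Proof.
pose f (z : R * R) := (expR ((h \_ Theta) z.2 * z.1 - n%:R * (K \_ Theta) z.2) *
  (prior \_ Theta) z.2)%:E.
have mr (g : R -> R) : measurable_fun Theta g ->
    measurable_fun setT (fun z : R * R => (g \_ Theta) z.2).
  move=> mg; apply: (@measurableT_comp _ _ _ _ _ _ (g \_ Theta)) => //.
  exact/(measurable_restrictT g mTheta).
have mf : measurable_fun setT f.
  apply/measurable_EFinP; apply: measurable_funM; last exact: mr.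
  apply: measurableT_comp => //; apply: measurable_funB.
    by apply: measurable_funM; [exact: mr|exact: measurable_fst].
  by apply: measurable_funM => //; exact: mr.
have f0 z : (0 <= f z)%E.
  rewrite lee_fin mulr_ge0 ?expR_ge0// patchE; case: ifPn => // /[!inE] zT.
  exact/ltW/prior_gt0.
have := measurable_fun_fubini_tonelli_F (m2 := lebesgue_measure) f mf f0.
congr (measurable_fun _ _); apply/funext => s.
rewrite /tilted_mass [RHS]integral_mkcond; apply: eq_integral => t _.
rewrite /f !patchE /=; case: ifPn => // _.
by rewrite mulr0.
Qed.

(** A vanishing mass would make [Theta] a null set, although the prior gives it
    mass one. *)
Lemma tilted_mass_gt0 n s : (0 < tilted_mass n s)%E.
Proof.
pose f t := (expR (h t * s - n%:R * K t) * prior t)%:E.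
have mf : measurable_fun Theta f by exact: measurable_tilted_integrand.
have f0 t : Theta t -> (0 < f t)%E.
  by move=> Tt; rewrite lte_fin mulr_gt0 ?expR_gt0// prior_gt0.
rewrite lt0e integral_ge0 ?andbT => [|t /f0/ltW//]; apply/eqP => m0.
have : (\int[lebesgue_measure]_(t in Theta) `|f t| = 0)%E.
  rewrite -m0; apply: eq_integral => t /[!inE] /f0/ltW ?.
  by rewrite gee0_abs.
move=> /(ae_eq_integral_abs lebesgue_measure mTheta mf).1 [N [mN N0 TN]].
have TsubN : Theta `<=` N.
  move=> t Tt; apply: TN => /= /(_ Tt) ft0.
  by have := f0 t Tt; rewrite ft0 ltxx.
have T0 : lebesgue_measure Theta = 0%E.
  by apply/eqP; rewrite -measure_le0 -N0 le_measure ?inE.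
have := prior1; rewrite null_set_integral//; last exact/measurable_EFinP.
by move/eqP; rewrite eq_sym onee_eq0.
Qed.

(** Measurability is transferred from the real power function of exponent [- 1];
    an infinite mass yields 0 on both sides, because [fine] sends it to 0 and
    [0 `^ (- 1)] is 0. *)
Lemma measurable_div_tilted_mass n (c : R) :
  measurable_fun setT (fun s => c%:E / tilted_mass n s)%E.
Proof.
have -> : (fun s => c%:E / tilted_mass n s)%E =
    (fun s => (c * (fine (tilted_mass n s)) `^ (- 1))%:E).
  apply/funext => s; have := tilted_mass_gt0 n s.
  case: (tilted_mass n s) => [r|_|//].
    by rewrite lte_fin => r0; rewrite inver gt_eqF//= powR_inv1 ?ltW.
  by rewrite invey mule0 /= powR0 ?mulr0// oppr_eq0 oner_eq0.
apply/measurable_EFinP; apply: measurable_funM => //.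
apply: (measurableT_comp (measurable_powR _)).
by apply: measurableT_comp => //; exact: measurable_tilted_mass.
Qed.

Section expectation.
Context d (X : measurableType d).
Variable nu : {sigma_finite_measure set X -> \bar R}.
Variables (p Y : X -> R).
Hypothesis p0 : forall x, 0 <= p x.
Hypothesis mp : measurable_fun setT p.
Hypothesis mY : measurable_fun setT Y.
Hypothesis p1 : (\int[nu]_x (p x)%:E = 1)%E.
Hypothesis iY : nu.-integrable setT (EFin \o (fun x => p x * Y x)).
Hypothesis iY2 : nu.-integrable setT (EFin \o (fun x => p x * Y x ^+ 2)).
Hypothesis iY3 : nu.-integrable setT (EFin \o (fun x => p x * `|Y x| ^+ 3)).
Hypothesis EY : \int[nu]_x (p x * Y x) = 0.
Hypothesis EY2 : \int[nu]_x (p x * Y x ^+ 2) = I.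

Lemma integral_sample_density n :
  (\int[power_measure nu n]_s (sample_density p s)%:E = 1)%E.
Proof.
have E := integral_sample_sum nu p0 mp mY n 0 (measurable_cst 1%E)
  (fun=> lee01).
transitivity (\int[power_measure nu n]_s
    ((sample_density p s)%:E * (cst 1%E (0 + sample_sum Y s)%R)))%E.
  have [m ->] := power_measure_sigma_finite nu n.
  by apply: eq_integral => s _; rewrite mule1.
rewrite E; elim: n 0 {E} => [//|n ih] y; rewrite iterS /walk_step.
by under eq_integral do rewrite ih mule1.
Qed.

(** The uniform error of the Gaussian profile passes through the expectation,
    because the sample density has mass one, and the expectation of the profile
    is given by the central limit theorem. *)
Lemma expected_posterior_estimate (e : R) : 0 < e -> \forall n \near \oo,
  (((Num.sqrt I / (2 * Num.sqrt pi) - e) * Num.sqrt n%:R)%:E <=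
   \int[power_measure nu n]_s ((prior t0)%:E / tilted_mass n (sample_sum Y s) *
     (sample_density p s)%:E) <=
   ((Num.sqrt I / (2 * Num.sqrt pi) + e) * Num.sqrt n%:R)%:E)%E.
Proof.
move=> e0; pose S0 : R := Num.sqrt (2 * pi / I).
have S00 : 0 < S0 by rewrite sqrtr_gt0 divr_gt0.
have e20 : 0 < e / 2 by rewrite divr_gt0.
have eS0 : 0 < e / 2 * S0 by rewrite mulr_gt0.
have cE : Num.sqrt I / (2 * Num.sqrt pi) = (Num.sqrt 2)^-1 / S0.
  have SE : S0 = Num.sqrt 2 * Num.sqrt pi / Num.sqrt I.
    by rewrite /S0 sqrtrM ?(ltW pi2)// sqrtrM// sqrtrV// ltW.
  have r22 : Num.sqrt 2 ^+ 2 = 2 :> R by rewrite sqr_sqrtr.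
  rewrite SE -[in LHS]r22; field.
  by rewrite !gt_eqF ?sqrtr_gt0 ?pi_gt0.
near=> n.
have n0 : (0 < n)%N by near: n; exact: nbhs_infty_gt.
have N0 : 0 < n%:R :> R by rewrite ltr0n.
have q0 : 0 < Num.sqrt n%:R :> R by rewrite sqrtr_gt0.
have prof : forall s,
    (((gauss_mass n s)^-1 - e / 2 * Num.sqrt n%:R)%:E <=
     (prior t0)%:E / tilted_mass n s <=
     ((gauss_mass n s)^-1 + e / 2 * Num.sqrt n%:R)%:E)%E.
  by near: n; apply: posterior_profile.
have : (((Num.sqrt 2)^-1 - e / 2 * S0)%:E <=
     \int[power_measure nu n]_s ((sample_density p s)%:E *
       (expR (- sample_sum Y s ^+ 2 / (2 * (I * n%:R))))%:E) <=
     ((Num.sqrt 2)^-1 + e / 2 * S0)%:E)%E.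
  by near: n; apply: gaussian_functional_clt.
have gE s : (gauss_mass n s)^-1 =
    Num.sqrt n%:R / S0 * expR (- s ^+ 2 / (2 * (I * n%:R))).
  by rewrite gauss_massE// invfM invf_div -expRN mulNr.
have mL : measurable_fun [set: n.-tuple X]
    (fun s => (sample_density p s)%:E).
  by apply/measurable_EFinP; exact: measurable_sample_density.
have L0 (s : n.-tuple X) : (0 <= (sample_density p s)%:E)%E.
  by rewrite lee_fin sample_density_ge0.
have mS : measurable_fun [set: n.-tuple X] (@sample_sum d X R Y n).
  exact: measurable_sample_sum.
have mE : measurable_fun [set: n.-tuple X] (fun s =>
    (expR (- sample_sum Y s ^+ 2 / (2 * (I * n%:R))))%:E).
  apply/measurable_EFinP; apply: measurableT_comp => //.
  apply: measurable_funM => //; apply: measurableT_comp => //.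
  exact: measurable_funX.
have mD : measurable_fun [set: n.-tuple X] (fun s =>
    ((prior t0)%:E / tilted_mass n (sample_sum Y s) *
     (sample_density p s)%:E)%E).
  apply: emeasurable_funM => //.
  exact: (measurableT_comp (measurable_div_tilted_mass _ _)).
have D0 s : (0 <= (prior t0)%:E / tilted_mass n s)%E.
  apply: mule_ge0; first by rewrite lee_fin ltW.
  by rewrite inve_ge0 ltW// tilted_mass_gt0.
have Lint := integral_sample_density n.
have [m pmE] := power_measure_sigma_finite nu n; rewrite pmE in Lint *.
set A := (\int[m]_s (_ * (expR _)%:E))%E => /andP[lo hi].
pose a : R := Num.sqrt n%:R / S0; have a0 : 0 <= a by rewrite divr_ge0 ?ltW.
pose b : R := e / 2 * Num.sqrt n%:R; have b0 : 0 <= b by rewrite mulr_ge0 ?ltW.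
have LE0 (s : n.-tuple X) : (0 <= (sample_density p s)%:E *
    (expR (- sample_sum Y s ^+ 2 / (2 * (I * n%:R))))%:E)%E.
  by rewrite mule_ge0// lee_fin expR_ge0.
have mLE : measurable_fun [set: n.-tuple X] (fun s => (sample_density p s)%:E *
    (expR (- sample_sum Y s ^+ 2 / (2 * (I * n%:R))))%:E)%E.
  exact: emeasurable_funM.
rewrite cE; apply/andP; split.
  apply: (@le_trans _ _ (a%:E * A - b%:E)%E).
    rewrite leeBrDr// -EFinD.
    apply: (@le_trans _ _ (a%:E * ((Num.sqrt 2)^-1 - e / 2 * S0)%:E)%E).
      rewrite -EFinM lee_fin le_eqVlt; apply/orP; left; apply/eqP.
      by rewrite /a /b; field; rewrite !gt_eqF// sqrtr_gt0.
    by apply: lee_wpmul2l => //; rewrite lee_fin.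
  rewrite leeBlDr// -ge0_integralZl_EFin//.
  rewrite -[X in (_ <= _ + X)%E]mule1 -Lint -ge0_integralZl_EFin//.
  rewrite -ge0_integralD//; first last.
  - by apply: measurable_funeM.
  - by move=> s _; rewrite mule_ge0// lee_fin.
  - by move=> s _; rewrite mule_ge0.
  apply: ge0_le_integral => //.
  - by move=> s _; rewrite mule_ge0// lee_fin.
  - exact: measurable_funeM.
  - by apply: emeasurable_funD => //; exact: measurable_funeM.
  move=> s _; rewrite -ge0_muleDl//.
  rewrite muleCA muleC; apply: lee_wpmul2r => //.
  have /andP[+ _] := prof (sample_sum Y s).
  by rewrite EFinB leeBlDr// gE -EFinM.
apply: (@le_trans _ _ (a%:E * A + b%:E)%E); last first.
  apply: (@le_trans _ _ (a%:E * ((Num.sqrt 2)^-1 + e / 2 * S0)%:E + b%:E)%E).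
    by apply: leeD => //; apply: lee_wpmul2l => //; rewrite lee_fin.
  rewrite -EFinM -EFinD lee_fin le_eqVlt; apply/orP; left; apply/eqP.
  by rewrite /a /b; field; rewrite !gt_eqF// sqrtr_gt0.
rewrite -ge0_integralZl_EFin//.
rewrite -[X in (_ <= _ + X)%E]mule1 -Lint -ge0_integralZl_EFin//.
rewrite -ge0_integralD//; first last.
- by apply: measurable_funeM.
- by move=> s _; rewrite mule_ge0// lee_fin.
- by apply: measurable_funeM.
- by move=> s _; rewrite mule_ge0// lee_fin.
apply: ge0_le_integral => //.
- by move=> s _; rewrite mule_ge0.
- by apply: emeasurable_funD; exact: measurable_funeM.
move=> s _; rewrite [(a%:E * _)%E]muleCA [(_%:E * (a%:E * _))%E]muleC.
rewrite -ge0_muleDl//; last by rewrite lee_fin mulr_ge0// expR_ge0.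
apply: lee_wpmul2r => //.
have /andP[_ +] := prof (sample_sum Y s).
by rewrite EFinD gE -EFinM.
Unshelve. all: by end_near.
Qed.

End expectation.

End laplace.

(** * Exponential moments and cumulants *)

Section exponential_moments.
Context d (X : measurableType d) (R : realType).
Variable nu : {measure set X -> \bar R}.
Variables (p Y : X -> R) (c : R).
Hypothesis p0 : forall x, 0 <= p x.
Hypothesis mp : measurable_fun setT p.
Hypothesis mY : measurable_fun setT Y.
Hypothesis c0 : 0 < c.
Hypothesis iP : nu.-integrable setT (EFin \o (fun x => p x * expR (c * Y x))).
Hypothesis iN : nu.-integrable setT (EFin \o (fun x => p x * expR (- c * Y x))).

Let mexp (z : R) : measurable_fun setT (fun x => expR (z * Y x)).
Proof. by apply: measurableT_comp => //; exact: measurable_funM. Qed.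

Let mabs (j : nat) : measurable_fun setT (fun x => `|Y x| ^+ j).
Proof. by apply: measurable_funX; exact: measurableT_comp. Qed.

Let mexpabs (z : R) : measurable_fun setT (fun x => expR (z * `|Y x|)).
Proof.
apply: measurableT_comp => //; apply: measurable_funM => //.
exact: measurableT_comp.
Qed.

Let expR_abs_le (z : R) : expR (c * `|z|) <= expR (c * z) + expR (- c * z).
Proof.
have [z0|z0] := leP 0 z.
  by rewrite ger0_norm// lerDl expR_ge0.
by rewrite ltr0_norm// mulrN mulNr lerDr expR_ge0.
Qed.

Lemma integrable_exp_abs :
  nu.-integrable setT (EFin \o (fun x => p x * expR (c * `|Y x|))).
Proof.
apply: (integrable_le _ _ (integrable_rD iP iN)).
  exact: measurable_funM.
move=> x; rewrite ger0_norm ?mulr_ge0 ?expR_ge0// -mulrDr ler_wpM2l//.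
Qed.

(** This is the cube of [z <= expR z] at [z = c / 6 * y]; the exponent [c / 2]
    leaves room for another factor [expR (c / 2 * y)]. *)
Lemma cube_le_exp (y : R) : 0 <= y -> y ^+ 3 <= (6 / c) ^+ 3 * expR (c / 2 * y).
Proof.
move=> y0; have -> : c / 2 * y = 3%:R * (c / 6 * y) by field.
rewrite expRM_natl -exprMn; have c60 : 0 < 6 / c by rewrite divr_gt0.
have y6 : y <= 6 / c * expR (c / 6 * y).
  rewrite -ler_pdivrMl// invf_div.
  by apply: le_trans (expR_ge1Dx _); rewrite lerDr.
by apply: lerXn2r y6; rewrite nnegrE// mulr_ge0 ?expR_ge0// ltW.
Qed.

Lemma integrable_cube_exp : nu.-integrable setT
  (EFin \o (fun x => p x * (`|Y x| ^+ 3 * expR (c / 2 * `|Y x|)))).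
Proof.
apply: (integrable_le _ _ (integrable_rZl ((6 / c) ^+ 3) integrable_exp_abs)).
  by apply: measurable_funM => //; exact: measurable_funM.
move=> x; rewrite ger0_norm; last first.
  by rewrite mulr_ge0// mulr_ge0 ?expR_ge0// exprn_ge0.
rewrite [leRHS]mulrCA ler_wpM2l//.
apply: le_trans (ler_wpM2r (expR_ge0 _) (cube_le_exp (normr_ge0 _))) _.
by rewrite -[leLHS]mulrA -expRD -mulrDl -splitr.
Qed.

Lemma integrable_norm_moment j : (j <= 3)%N ->
  nu.-integrable setT (EFin \o (fun x => p x * `|Y x| ^+ j)).
Proof.
move=> j3; apply: (integrable_le _ _
  (integrable_rD integrable_exp_abs integrable_cube_exp)).
  exact: measurable_funM.
move=> x; rewrite ger0_norm ?mulr_ge0 ?exprn_ge0// -mulrDr ler_wpM2l//.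
have y0 := normr_ge0 (Y x); set y := `|Y x| in y0 *.
have e1 (z : R) : 0 < z -> 1 <= expR (z * y).
  by move=> z0; rewrite -[leLHS]expR0 ler_expR mulr_ge0// ltW.
have [y1|/ltW y1] := leP y 1.
  apply: (le_trans (exprn_ile1 _ _ _)) => //; apply: (le_trans (e1 c c0)).
  by rewrite lerDl mulr_ge0 ?expR_ge0 ?exprn_ge0.
apply: ler_wpDl; first exact: expR_ge0.
apply: (le_trans (ler_weXn2l y1 j3)).
by rewrite ler_peMr ?exprn_ge0// e1// divr_gt0.
Qed.

Lemma integrable_moment j : (j <= 3)%N ->
  nu.-integrable setT (EFin \o (fun x => p x * Y x ^+ j)).
Proof.
move=> j3; apply: (integrable_le _ _ (integrable_norm_moment j3)).
  by apply: measurable_funM => //; exact: measurable_funX.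
by move=> x; rewrite normrM normrX (ger0_norm (p0 x)).
Qed.

Lemma integrable_exp (z : R) : `|z| <= c ->
  nu.-integrable setT (EFin \o (fun x => p x * expR (z * Y x))).
Proof.
move=> zc; apply: (integrable_le _ _ integrable_exp_abs).
  exact: measurable_funM.
move=> x; rewrite ger0_norm ?mulr_ge0 ?expR_ge0// ler_wpM2l// ler_expR.
by apply: (le_trans (ler_norm _)); rewrite normrM ler_wpM2r.
Qed.

Lemma expR_taylor2 (y : R) :
  `|expR y - (1 + y + y ^+ 2 / 2)| <= `|y| ^+ 3 * expR `|y|.
Proof.
have := @taylor2_bound R expR expR expR expR 0 y (expR `|y|)
  (fun z _ => is_derive_expR z) (fun z _ => is_derive_expR z)
  (fun z _ => is_derive_expR z).
rewrite add0r expR0 !mul1r [leRHS]mulrC !opprD !addrA; apply=> z.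
rewrite subr0 => zy; rewrite ger0_norm ?expR_ge0// ler_expR.
exact: le_trans (ler_norm _) zy.
Qed.

Hypothesis p1 : \int[nu]_x p x = 1.
Hypothesis EY : \int[nu]_x (p x * Y x) = 0.

Let v := \int[nu]_x (p x * Y x ^+ 2).

Lemma mgf_taylor2 : exists2 M : R, 0 <= M & forall z, `|z| <= c / 2 ->
  `|\int[nu]_x (p x * expR (z * Y x)) - (1 + v / 2 * z ^+ 2)| <= M * `|z| ^+ 3.
Proof.
exists (\int[nu]_x (p x * (`|Y x| ^+ 3 * expR (c / 2 * `|Y x|)))).
  apply: Rintegral_ge0 => x _.
  by rewrite mulr_ge0// mulr_ge0 ?expR_ge0 ?exprn_ge0.
move=> z zc.
have i0 : nu.-integrable setT (EFin \o p).
  by have := integrable_moment (leq0n 3); under eq_fun do rewrite mulr1.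
have i1 : nu.-integrable setT (EFin \o (fun x => p x * Y x)).
  exact: (integrable_moment (isT : (1 <= 3)%N)).
have i2 := integrable_moment (isT : (2 <= 3)%N).
pose g x := p x + (z * (p x * Y x) + z ^+ 2 / 2 * (p x * Y x ^+ 2)).
have i12 :=
  integrable_rD (integrable_rZl z i1) (integrable_rZl (z ^+ 2 / 2) i2).
have ig : nu.-integrable setT (EFin \o g) by exact: integrable_rD.
have -> : 1 + v / 2 * z ^+ 2 = \int[nu]_x g x.
  rewrite RintegralD// RintegralD//; try exact: integrable_rZl.
  by rewrite !RintegralZl// p1 EY /v; field.
have zc' : `|z| <= c.
  by apply: (le_trans zc); rewrite [leRHS]splitr lerDl divr_ge0// ltW.
rewrite mulrC -RintegralZl//; last exact: integrable_cube_exp.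
apply: dist_Rintegral_le => //.
- exact: integrable_exp.
- by apply: integrable_rZl; exact: integrable_cube_exp.
move=> x; have -> : p x * expR (z * Y x) - g x =
    p x * (expR (z * Y x) - (1 + z * Y x + (z * Y x) ^+ 2 / 2)).
  by rewrite /g; field.
rewrite normrM (ger0_norm (p0 x)) [leRHS]mulrCA ler_wpM2l//.
apply: (le_trans (expR_taylor2 _)); rewrite normrM exprMn -[leLHS]mulrA.
apply: ler_wpM2l; first exact: exprn_ge0.
apply: ler_wpM2l; first exact: exprn_ge0.
by rewrite ler_expR ler_wpM2r.
Qed.

(** The expansion of the moment generating function carries over to its
    logarithm.  The logarithm enters as any [k] with the right exponential,
    since in a tilted family the cumulant function is only known in this
    way. *)
Lemma cumulant_expansion (e : R) : 0 < e -> exists2 de : R, 0 < de &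
  forall z k, `|z| <= de -> \int[nu]_x (p x * expR (z * Y x)) = expR k ->
    `|k - v / 2 * z ^+ 2| <= e * z ^+ 2.
Proof.
move=> e0; have [M M0 HM] := mgf_taylor2.
have v0 : 0 <= v.
  by apply: Rintegral_ge0 => x _; rewrite mulr_ge0// sqr_ge0.
pose B := M + 1; have B0 : 0 < B by rewrite /B; lra.
pose V := v + 1; have V1 : 1 <= V by rewrite /V; lra.
have V0 : 0 < V by lra.
pose de := Num.min (Num.min (c / 2) (1 / (2 * B)))
  (Num.min (e / (2 * B)) (Num.min (1 / (2 * V)) (e / (4 * V ^+ 2)))).
exists de.
  by rewrite !lt_min !divr_gt0// mulr_gt0// exprn_gt0.
move=> z k; rewrite !le_min => /andP[/andP[zc zB] /and3P[ze zV zeV]] kE.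
have := HM z zc; rewrite kE; set w := expR k - 1.
rewrite (_ : expR k - _ = w - v / 2 * z ^+ 2); last by rewrite /w; ring.
have a0 := normr_ge0 z; have z2 := sqr_ge0 z.
have zz : z ^+ 2 = `|z| * `|z| by rewrite -expr2 real_normK// num_real.
rewrite ler_pdivlMr ?mulr_gt0// in zB; rewrite ler_pdivlMr ?mulr_gt0// in ze.
rewrite ler_pdivlMr ?mulr_gt0// in zV.
rewrite ler_pdivlMr ?mulr_gt0 ?exprn_gt0// in zeV.
have -> : M * `|z| ^+ 3 = M * `|z| * z ^+ 2 by rewrite zz; ring.
move=> Hw.
have Mz1 : M * `|z| <= 2^-1.
  have : M * `|z| <= B * `|z| by rewrite ler_wpM2r// /B; lra.
  lra.
have Mze : M * `|z| <= e / 2.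
  have : M * `|z| <= B * `|z| by rewrite ler_wpM2r// /B; lra.
  lra.
have h1 := ler_wpM2r z2 Mz1; have h2 := ler_wpM2r z2 Mze.
have wV : `|w| <= V * z ^+ 2.
  have vz := mulr_ge0 v0 z2.
  rewrite -[w](subrK (v / 2 * z ^+ 2)) (le_trans (ler_normD _ _))//.
  rewrite (@ger0_norm _ (v / 2 * z ^+ 2)); last by rewrite mulr_ge0// divr_ge0.
  by rewrite /V; lra.
have z1 : `|z| <= 1.
  by apply: le_trans (_ : `|z| * (2 * V) <= 1) => //; rewrite ler_peMr//; lra.
have Vz2 : V * z ^+ 2 <= 2^-1.
  have : V * z ^+ 2 <= V * `|z| by rewrite ler_pM2l// zz ler_piMl.
  lra.
have w2 : `|w| ^+ 2 <= e / 4 * z ^+ 2.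
  apply: (@le_trans _ _ ((V * z ^+ 2) ^+ 2)).
    by rewrite lerXn2r// nnegrE// mulr_ge0// ltW.
  rewrite exprMn [(z ^+ 2) ^+ 2]expr2 mulrA ler_wpM2r//.
  apply: (@le_trans _ _ (V ^+ 2 * `|z|)); last lra.
  by rewrite ler_pM2l ?exprn_gt0// zz ler_piMl.
have w12 : `|w| <= 2^-1 by exact: le_trans Vz2.
rewrite real_normK ?num_real// in w2.
have kw : k <= w by rewrite /w lerBrDl expR_ge1Dx.
have wk : w - 2 * w ^+ 2 <= k.
  have := expR_ge1Dx (- k); rewrite expRN => h.
  have E : expR k = 1 + w by rewrite /w; ring.
  rewrite E in h; move: w12; rewrite ler_norml => /andP[w3 w4].
  have w1 : 0 < 1 + w by lra.
  have h' : (1 - k) * (1 + w) <= 1 by rewrite -ler_pdivlMr// div1r.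
  nra.
move: Hw; rewrite !ler_norml => /andP[b1 b2].
by apply/andP; split; lra.
Qed.

End exponential_moments.

(** Bernoulli's inequality [1 + r * (x - 1) <= x ^ r], with [x = expR y]. *)
Lemma expR_bernoulli {R : realType} (r y : R) : 1 <= r ->
  1 + r * (expR y - 1) <= expR (r * y).
Proof.
move=> r1; have -> : r * y = y + (r - 1) * y by ring.
have y1 := expR_ge1Dx ((r - 1) * y).
have := expR_ge1Dx (- y); rewrite expRN => y2.
have E0 : 0 < expR y by exact: expR_gt0.
have y3 : (1 - y) * expR y <= 1 by rewrite -ler_pdivlMr// div1r.
rewrite expRD; apply: le_trans (ler_wpM2l (ltW E0) y1).
by nra.
Qed.

(** The cumulant generating function is star-shaped about the origin, by
    Bernoulli's inequality applied pointwise under the integral; this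
    consequence of its convexity makes it grow at least linearly. *)
Lemma cumulant_star d (X : measurableType d) (R : realType)
    (nu : {measure set X -> \bar R}) (p Y : X -> R) (z1 k1 z k r : R) :
  (forall x, 0 <= p x) -> nu.-integrable setT (EFin \o p) ->
  \int[nu]_x p x = 1 ->
  nu.-integrable setT (EFin \o (fun x => p x * expR (z1 * Y x))) ->
  nu.-integrable setT (EFin \o (fun x => p x * expR (z * Y x))) ->
  \int[nu]_x (p x * expR (z1 * Y x)) = expR k1 ->
  \int[nu]_x (p x * expR (z * Y x)) = expR k ->
  1 <= r -> z = r * z1 -> r * k1 <= k.
Proof.
move=> p0 ip p1 i1 iz E1 Ez r1 zr.
rewrite -subr_ge0 -ler_expR expR0 expRD -Ez expRN mulrC -expRN.
rewrite -RintegralZl//.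
have j1 := integrable_rZl (r * expR (- k1)) i1.
have j2 := integrable_rZl (1 - r) ip.
apply: (@le_trans _ _ (\int[nu]_x ((1 - r) * p x +
    r * expR (- k1) * (p x * expR (z1 * Y x))))).
  rewrite RintegralD// !RintegralZl// p1 E1 -mulrA -expRD addNr expR0.
  by rewrite le_eqVlt; apply/orP; left; apply/eqP; ring.
apply: le_Rintegral => //; [exact: integrable_rD|exact: integrable_rZl|].
move=> x _; have := expR_bernoulli (z1 * Y x - k1) r1.
move=> /(ler_wpM2l (p0 x)); rewrite zr.
rewrite (_ : r * (z1 * Y x - k1) = r * z1 * Y x + - (r * k1)); last by ring.
rewrite !expRD => h.
apply: le_trans (le_trans _ h) _; rewrite le_eqVlt; apply/orP; left; apply/eqP.
  by ring.
by ring.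
Qed.

(** * Exponential tilts around an interior parameter *)

Section tilted_family.
Context d (X : measurableType d) (R : realType).
Variable nu : {sigma_finite_measure set X -> \bar R}.
Variables (p Y : X -> R) (Theta : set R) (h K : R -> R) (t0 : R).
Hypothesis p0 : forall x, 0 <= p x.
Hypothesis mp : measurable_fun setT p.
Hypothesis mY : measurable_fun setT Y.
Hypothesis mTheta : measurable Theta.
Hypothesis mh : measurable_fun Theta h.
Hypothesis hmono : forall s t, Theta s -> Theta t -> s < t -> h s < h t.
Hypothesis ht0 : h t0 = 0.
Hypothesis Kt0 : K t0 = 0.
Hypothesis tilt : forall t, Theta t ->
  (\int[nu]_x (p x * expR (h t * Y x))%:E = (expR (K t))%:E)%E.
Hypothesis h_near : forall e : R, 0 < e -> exists2 de : R, 0 < de &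
  forall t, `|t - t0| <= de -> Theta t /\ `|h t - (t - t0)| <= e * `|t - t0|.

Let Theta0 : Theta t0.
Proof.
have [de de0 /(_ t0)] := h_near ltr01.
by rewrite subrr normr0 => /(_ (ltW de0))[].
Qed.

Lemma integrable_tilt t : Theta t ->
  nu.-integrable setT (EFin \o (fun x => p x * expR (h t * Y x))).
Proof.
move=> Tt; apply/integrableP; split.
  apply/measurable_EFinP; apply: measurable_funM => //.
  by apply: measurableT_comp => //; exact: measurable_funM.
under eq_integral do rewrite /= ger0_norm ?mulr_ge0 ?expR_ge0//.
by rewrite tilt// ltry.
Qed.

Lemma Rintegral_tilt t : Theta t ->
  \int[nu]_x (p x * expR (h t * Y x)) = expR (K t).
Proof. by move=> Tt; rewrite /Rintegral tilt. Qed.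

Lemma tilted_density_mass1 : (\int[nu]_x (p x)%:E = 1)%E.
Proof.
have := tilt Theta0; rewrite ht0 Kt0 expR0 => <-.
by apply: eq_integral => x _; rewrite mul0r expR0 mulr1.
Qed.

Lemma integrable_tilted_density : nu.-integrable setT (EFin \o p).
Proof.
apply/integrableP; split; first exact/measurable_EFinP.
under eq_integral do rewrite /= ger0_norm//.
by rewrite tilted_density_mass1 ltry.
Qed.

(** Points of [Theta] on both sides of [t0] give exponential moments of both
    signs. *)
Lemma exponential_moment_exists : exists2 c : R, 0 < c &
  nu.-integrable setT (EFin \o (fun x => p x * expR (c * Y x))) /\
  nu.-integrable setT (EFin \o (fun x => p x * expR (- c * Y x))).
Proof.
have [de de0 near0] := h_near ltr01.
have T1 : Theta (t0 + de).
  by apply: (near0 _ _).1; rewrite addrC addKr ger0_norm// ltW.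
have T2 : Theta (t0 - de).
  by apply: (near0 _ _).1; rewrite addrC addKr normrN ger0_norm// ltW.
have h1 : 0 < h (t0 + de) by rewrite -ht0; apply: hmono => //; rewrite ltrDl.
have h2 : h (t0 - de) < 0.
  by rewrite -ht0; apply: hmono => //; rewrite ltrBlDr ltrDl.
pose c := Num.min (h (t0 + de)) (- h (t0 - de)).
have c0 : 0 < c by rewrite lt_min h1 oppr_gt0.
have [c1 c2] : c <= h (t0 + de) /\ c <= - h (t0 - de).
  by rewrite !ge_min !lexx orbT.
have dom (z : R) : `|z| <= c ->
    nu.-integrable setT (EFin \o (fun x => p x * expR (z * Y x))).
  move=> zc; apply: (integrable_le _ _ (integrable_rD integrable_tilted_density
      (integrable_rD (integrable_tilt T1) (integrable_tilt T2)))).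
    apply: measurable_funM => //.
    by apply: measurableT_comp => //; exact: measurable_funM.
  move=> x; rewrite ger0_norm ?mulr_ge0 ?expR_ge0//.
  rewrite -mulrDr -[X in X + _](mulr1 (p x)) -mulrDr ler_wpM2l//.
  have zY : z * Y x <= c * `|Y x|.
    by apply: (le_trans (ler_norm _)); rewrite normrM ler_wpM2r.
  have [y0|y0] := leP 0 (Y x).
    apply: (@le_trans _ _ (expR (h (t0 + de) * Y x))).
      rewrite ler_expR (le_trans zY)// ger0_norm// ler_wpM2r//.
    by rewrite addrCA lerDl addr_ge0 ?expR_ge0.
  apply: (@le_trans _ _ (expR (h (t0 - de) * Y x))).
    rewrite ler_expR (le_trans zY)// ltr0_norm// mulrN -mulNr.
    by rewrite ler_nM2r// lerNr.
  by rewrite addrA lerDr addr_ge0 ?expR_ge0.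
by exists c => //; split; apply: dom; rewrite ?normrN ger0_norm// ltW.
Qed.

(** On [Theta] the function [K] is the logarithm of a parametric integral, which
    is measurable by Tonelli's theorem. *)
Lemma measurable_cumulant : measurable_fun Theta K.
Proof.
pose f (z : R * X) := (p z.2 * expR ((h \_ Theta) z.1 * Y z.2))%:E.
have mf : measurable_fun setT f.
  apply/measurable_EFinP; apply: measurable_funM; first exact: measurableT_comp.
  apply: measurableT_comp => //; apply: measurable_funM.
    apply: (@measurableT_comp _ _ _ _ _ _ (h \_ Theta)) => //.
    exact/(measurable_restrictT h mTheta).
  exact: measurableT_comp.
have f0 z : (0 <= f z)%E by rewrite lee_fin mulr_ge0 ?expR_ge0.
have mF := measurable_fun_fubini_tonelli_F (m2 := nu) f mf f0.
have mG : measurable_fun Theta (fun t => ln (fine (fubini_F nu f t))).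
  apply: measurable_funTS; apply: measurableT_comp => //.
  exact: measurableT_comp.
apply: eq_measurable_fun mG => t /[!inE] Tt.
rewrite /fubini_F /f /= patchE mem_set//=.
by rewrite tilt//= expRK.
Qed.

Hypothesis EY : \int[nu]_x (p x * Y x) = 0.

Let I := \int[nu]_x (p x * Y x ^+ 2).

Hypothesis I0 : 0 < I.

Let Ep : \int[nu]_x p x = 1.
Proof. by rewrite /Rintegral tilted_density_mass1. Qed.

(** This is the expansion of the cumulant function at [z = h t], which differs
    from [t - t0] by [o(t - t0)]. *)
Lemma cumulant_near (e : R) : 0 < e -> exists2 de : R, 0 < de &
  forall t, `|t - t0| <= de ->
    `|K t - I / 2 * (t - t0) ^+ 2| <= e * (t - t0) ^+ 2.
Proof.
move=> e0; have [c c0 [iP iN]] := exponential_moment_exists.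
have [dz dz0 cum] : exists2 dz : R, 0 < dz &
  forall z k, `|z| <= dz -> \int[nu]_x (p x * expR (z * Y x)) = expR k ->
    `|k - I / 2 * z ^+ 2| <= e / 8 * z ^+ 2.
  by apply: (cumulant_expansion p0 mp mY c0 iP iN Ep EY); rewrite divr_gt0.
pose g : R := Num.min 1 (e / (3 * I)).
have g0 : 0 < g by rewrite lt_min ltr01 divr_gt0// mulr_gt0.
have g1 : g <= 1 by rewrite ge_min lexx.
have gI : g * (3 * I) <= e.
  by rewrite -ler_pdivlMr ?mulr_gt0// ge_min lexx orbT.
have [dh dh0 hn] := h_near g0.
exists (Num.min dh (dz / 2)); first by rewrite lt_min dh0 divr_gt0.
move=> t; rewrite le_min => /andP[tdh tdz].
have [Tt ht] := hn t tdh.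
set u := t - t0 in ht tdh tdz *.
have u0 := normr_ge0 u.
have ht1 : `|h t - u| <= `|u| by apply: (le_trans ht); rewrite ler_piMl.
have h2u : `|h t| <= 2 * `|u|.
  by rewrite -[h t](subrK u) (le_trans (ler_normD _ _))//; lra.
have hdz : `|h t| <= dz by lra.
have := cum _ _ hdz (Rintegral_tilt Tt).
have h2 : h t ^+ 2 <= 4 * u ^+ 2.
  rewrite -(real_normK (num_real (h t))) -(real_normK (num_real u)).
  have := normr_ge0 (h t); nra.
have hu : `|h t ^+ 2 - u ^+ 2| <= 3 * g * u ^+ 2.
  rewrite subr_sqr normrM -[u ^+ 2]real_normK ?num_real//.
  have : `|h t + u| <= 3 * `|u|.
    by apply: (le_trans (ler_normD _ _)); lra.
  move=> s3; apply: (le_trans (ler_pM _ _ ht s3)) => //.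
  by rewrite le_eqVlt; apply/orP; left; apply/eqP; ring.
have u2 := sqr_ge0 u; have h20 := sqr_ge0 (h t).
have I2 : I / 2 * `|h t ^+ 2 - u ^+ 2| <= e / 2 * u ^+ 2.
  apply: (@le_trans _ _ (I / 2 * (3 * g * u ^+ 2))).
    by rewrite ler_pM2l// divr_gt0.
  rewrite [leLHS](_ : _ = g * (3 * I) / 2 * u ^+ 2); last by ring.
  by rewrite ler_wpM2r// ler_pM2r ?invr_gt0.
have eh : e / 8 * h t ^+ 2 <= e / 2 * u ^+ 2.
  rewrite (_ : e / 2 * u ^+ 2 = e / 8 * (4 * u ^+ 2)); last by field.
  by rewrite ler_pM2l// divr_gt0.
move=> cK; rewrite (_ : K t - I / 2 * u ^+ 2 = K t - I / 2 * h t ^+ 2 +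
  I / 2 * (h t ^+ 2 - u ^+ 2)); last by ring.
apply: (le_trans (ler_normD _ _)).
rewrite [X in _ + X]normrM (@ger0_norm _ (I / 2)) ?divr_ge0 ?(ltW I0)//.
lra.
Qed.

(** At the two points at a small distance [r] from [t0] the quadratic expansion
    makes [K] positive; star-shapedness propagates this along the rays through
    these points, on which [h] is monotone. *)
Lemma cumulant_far (de : R) : 0 < de -> exists c : R, 0 < c /\
  forall t, Theta t -> de < `|t - t0| -> c <= `|h t| /\ c * `|h t| <= K t.
Proof.
move=> de0; have [d1 d10 Kn] := cumulant_near (divr_gt0 I0 (ltr0n R 4)).
have [d2 d20 hn] := h_near ltr01.
pose r := Num.min de (Num.min d1 d2).
have r0 : 0 < r by rewrite !lt_min de0 d10.
have [rde [rd1 rd2]] : r <= de /\ r <= d1 /\ r <= d2.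
  by rewrite !ge_min !lexx !orbT.
have ray (z t : R) : `|z - t0| = r -> Theta t -> 1 <= h t / h z ->
    [/\ 0 < K z, h z != 0 & h t / h z * K z <= K t].
  move=> zr Tt ht.
  have Tz : Theta z by apply: (hn _ _).1; rewrite zr.
  have hz : h z != 0.
    by apply: contraL ht => /eqP ->; rewrite invr0 mulr0 -ltNge.
  split => //.
    have := Kn z; rewrite zr => /(_ rd1).
    rewrite -[(z - t0) ^+ 2]real_normK ?num_real// zr ler_distl => /andP[+ _].
    have := mulr_gt0 I0 (exprn_gt0 2 r0); lra.
  apply: (cumulant_star p0 integrable_tilted_density Ep
    (integrable_tilt Tz) (integrable_tilt Tt)) => //.
  - exact: Rintegral_tilt.
  - exact: Rintegral_tilt.
  - by rewrite divfK.
have n1 : `|t0 + r - t0| = r by rewrite addrC addKr ger0_norm// ltW.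
have n2 : `|t0 - r - t0| = r by rewrite addrC addKr normrN ger0_norm// ltW.
have T1 : Theta (t0 + r) by apply: (hn _ _).1; rewrite n1.
have T2 : Theta (t0 - r) by apply: (hn _ _).1; rewrite n2.
have h1 : 0 < h (t0 + r) by rewrite -ht0; apply: hmono => //; rewrite ltrDl.
have h2 : h (t0 - r) < 0.
  by rewrite -ht0; apply: hmono => //; rewrite ltrBlDr ltrDl.
have q1 : 1 <= h (t0 + r) / h (t0 + r) by rewrite divff// gt_eqF.
have q2 : 1 <= h (t0 - r) / h (t0 - r) by rewrite divff// lt_eqF.
have [K1 _ _] := ray _ _ n1 T1 q1; have [K2 _ _] := ray _ _ n2 T2 q2.
pose c := Num.min (Num.min (h (t0 + r)) (- h (t0 - r)))
  (Num.min (K (t0 + r) / h (t0 + r)) (K (t0 - r) / - h (t0 - r))).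
exists c; split.
  by rewrite !lt_min h1 oppr_gt0 h2 !divr_gt0// oppr_gt0.
have [[c1 c2] [c3 c4]] : (c <= h (t0 + r) /\ c <= - h (t0 - r)) /\
    (c <= K (t0 + r) / h (t0 + r) /\ c <= K (t0 - r) / - h (t0 - r)).
  by rewrite !ge_min !lexx !orbT.
move=> t Tt tde; have rt : r < `|t - t0| by exact: le_lt_trans tde.
have [tt|tt] := leP 0 (t - t0).
  have rt' : t0 + r < t by rewrite ger0_norm// in rt; rewrite -ltrBrDl.
  have hh : h (t0 + r) < h t by exact: hmono.
  have ht : 0 < h t by exact: lt_trans hh.
  rewrite (gtr0_norm ht); split; first by apply: (le_trans c1); exact: ltW.
  have [] := ray _ _ n1 Tt; first by rewrite ler_pdivlMr// mul1r ltW.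
  move=> _ _; apply: le_trans; rewrite mulrAC -mulrA mulrC.
  by rewrite ler_wpM2l// ltW.
have rt' : t < t0 - r by rewrite ltr0_norm// in rt; lra.
have hh : h t < h (t0 - r) by exact: hmono.
have ht : h t < 0 by exact: lt_trans h2.
rewrite (ltr0_norm ht); split; first by apply: (le_trans c2); rewrite lerN2 ltW.
have [] := ray _ _ n2 Tt; first by rewrite ler_ndivlMr// mul1r ltW.
move=> _ _; apply: le_trans; rewrite (_ : h t / h (t0 - r) * K (t0 - r) =
  K (t0 - r) / - h (t0 - r) * - h t); last by field; rewrite lt_eqF.
by rewrite ler_wpM2r// oppr_ge0 ltW.
Qed.

End tilted_family.

(** * Functions with a positive relative derivative *)

Section positive_derivative.
Context {R : realType}.
Variables (Theta : set R) (eta : R -> R).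
Hypothesis Theta_convex : convex_set (Theta : set R^o).
Hypothesis eta_derivable : forall t, Theta t -> derivable_within Theta eta t.
Hypothesis eta_derive_gt0 : forall t, Theta t -> 0 < derive_within Theta eta t.

Lemma convex_set_is_interval : is_interval Theta.
Proof.
move=> x y Tx Ty z /andP[xz zy].
have [xy|xy] := eqVneq x y; first by move: xz zy; rewrite -xy => ? ?;
  rewrite (_ : z = x)//; apply/eqP; rewrite eq_le; apply/andP.
have yx0 : 0 < y - x by rewrite subr_gt0 lt_neqAle xy (le_trans xz).
pose l := (y - z) / (y - x).
have l0 : 0 <= l by rewrite divr_ge0 ?subr_ge0 ?(le_trans xz).
have l1 : l <= 1 by rewrite ler_pdivrMr// mul1r lerD2l lerN2.
have := @Theta_convex x y (Itv01 l0 l1); rewrite !inE => /(_ Tx Ty).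
congr Theta; transitivity (l * x + (1 - l) * y); first by [].
by rewrite /l; field; rewrite gt_eqF.
Qed.

Lemma derive_within_near t (e : R) : Theta t -> 0 < e ->
  exists2 de : R, 0 < de & forall u, Theta u -> `|u - t| <= de ->
    `|eta u - eta t - derive_within Theta eta t * (u - t)| <= e * `|u - t|.
Proof.
move=> Tt e0; have /cvgrPdist_le /(_ _ e0) := eta_derivable Tt.
move=> /nbhs_ballP[de /= de0 near_t].
exists (de / 2); first by rewrite divr_gt0.
move=> u Tu ut; have [->|un] := eqVneq u t.
  by rewrite !subrr mulr0 subrr normr0 mulr0.
have utde : ball t de u.
  rewrite -ball_normE/= distrC; apply: le_lt_trans ut _.
  by rewrite ltr_pdivrMr// ltr_pMr// ltr1n.
have := near_t u utde un Tu; have ut0 : u - t != 0 by rewrite subr_eq0.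
rewrite distrC => h.
have -> : eta u - eta t - derive_within Theta eta t * (u - t) =
  ((eta u - eta t) / (u - t) - derive_within Theta eta t) * (u - t).
  by rewrite mulrBl divfK.
by rewrite normrM ler_wpM2r.
Qed.

Lemma eta_continuous : {within Theta, continuous eta}.
Proof.
apply/subspace_continuousP => t Tt; apply/cvgrPdist_le => e e0.
have [de de0 near_t] := derive_within_near Tt ltr01.
pose a := derive_within Theta eta t; have a0 : 0 < a by exact: eta_derive_gt0.
apply/nbhs_ballP; exists (Num.min de (e / (a + 1))) => /=.
  by rewrite lt_min de0 divr_gt0// addr_gt0.
move=> u; rewrite -ball_normE/= lt_min distrC => /andP[ude uea] Tu.
have := near_t u Tu (ltW ude); rewrite -/a => h.
rewrite distrC -(subrK (a * (u - t)) (eta u - eta t)).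
apply: (le_trans (ler_normD _ _)); rewrite [X in _ + X]normrM (gtr0_norm a0).
apply: (le_trans (lerD h (lexx _))); rewrite mul1r addrC.
rewrite ltr_pdivlMr ?addr_gt0// in uea.
by apply: (le_trans _ (ltW uea)); rewrite mulrDr mulr1 mulrC.
Qed.

Let eta_local t : Theta t -> exists2 de : R, 0 < de & forall u, Theta u ->
  `|u - t| <= de -> (t < u -> eta t < eta u) /\ (u < t -> eta u < eta t).
Proof.
move=> Tt; have a0 := eta_derive_gt0 Tt; set a := derive_within _ _ _ in a0.
have a20 : 0 < a / 2 by rewrite divr_gt0.
have [de de0 near_t] := derive_within_near Tt a20.
exists de => // u Tu ut; have := near_t u Tu ut; rewrite -/a => h.
split=> tu.
  have u0 : 0 < u - t by rewrite subr_gt0.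
  rewrite (gtr0_norm u0) ler_norml in h; move/andP: h => [h _].
  have := mulr_gt0 a20 u0; lra.
have u0 : u - t < 0 by rewrite subr_lt0.
rewrite (ltr0_norm u0) ler_norml in h; move/andP: h => [_ h].
have : 0 < a / 2 * (t - u) by rewrite mulr_gt0// subr_gt0.
lra.
Qed.

(** The minimum of [eta] over a segment can only be at the left endpoint,
    because just to the left of any other point [eta] takes smaller values. *)
Lemma eta_strict_mono s t : Theta s -> Theta t -> s < t -> eta s < eta t.
Proof.
have iT := convex_set_is_interval.
have weak a b : Theta a -> Theta b -> a <= b -> eta a <= eta b.
  move=> Ta Tb ab; have sub : `[a, b] `<=` Theta.
    by move=> z /=; rewrite in_itv/= => abz; exact: iT abz.
  have [c cab cmin] := EVT_min ab (continuous_subspaceW sub eta_continuous).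
  have [ac|ac] := eqVneq a c.
    by rewrite ac; apply: cmin; rewrite in_itv/= ab lexx.
  move: (cab); rewrite in_itv/= => /andP[ca cb].
  have Tc : Theta c by apply: sub.
  have {}ca : a < c by rewrite lt_neqAle ac.
  have [de de0 loc] := eta_local Tc.
  pose u := Num.max a (c - de).
  have ua : a <= u by rewrite le_max lexx.
  have ude : c - de <= u by rewrite le_max lexx orbT.
  have uc : u < c by rewrite gt_max ca ltrBlDr ltrDl.
  have uab : u \in `[a, b] by rewrite in_itv/= ua (le_trans (ltW uc)).
  have [||_ /(_ uc)] := loc u; first exact: sub.
    by rewrite ltr0_norm ?subr_lt0//; lra.
  by rewrite ltNge cmin.
move=> Ts Tt st; have [de de0 loc] := eta_local Ts.
pose u := Num.min t (s + de).
have ut : u <= t by rewrite ge_min lexx.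
have ude : u <= s + de by rewrite ge_min lexx orbT.
have su : s < u by rewrite lt_min st ltrDl.
have Tu : Theta u by apply: (iT s t) => //; rewrite (ltW su).
have [|/(_ su) stu _] := loc u Tu; first by rewrite gtr0_norm ?subr_gt0//; lra.
by apply: (lt_le_trans stu); exact: weak.
Qed.

(** The point [u] lies strictly between [s] and [t], so that it is interior even
    when these are endpoints of [Theta]. *)
Lemma eta_midpoint s t : Theta s -> Theta t -> t <> s ->
  let u := pinv Theta eta ((eta s + eta t) / 2) in
  [/\ Theta u, eta u = (eta s + eta t) / 2 & Theta^° u].
Proof.
have iT := convex_set_is_interval.
move=> Ts Tt ts.
wlog : s t Ts Tt ts / s < t => [wl|].
  have [st|st|st] := ltgtP s t; [exact: wl| |by case: ts].
  by rewrite addrC; apply: wl => //; exact/nesym.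
move=> st u; set y := (eta s + eta t) / 2 in u *.
have sub : `[s, t] `<=` Theta.
  by move=> z /=; rewrite in_itv/= => stz; exact: iT stz.
have est := eta_strict_mono Ts Tt st.
have [c cst cy] : exists2 c, c \in `[s, t] & eta c = y.
  apply: IVT; [exact: ltW|exact: continuous_subspaceW sub eta_continuous|].
  by rewrite min_l ?max_r ?(ltW est)//; rewrite /y; lra.
have Tc : Theta c by apply: sub.
have yim : (eta @` Theta) y by exists c.
have uE : eta u = y by rewrite /u pinvK// inE.
have inj a b : Theta a -> Theta b -> eta a = eta b -> a = b.
  move=> Ta Tb ab; have [h|h|//] := ltgtP a b.
    by have := eta_strict_mono Ta Tb h; rewrite ab ltxx.
  by have := eta_strict_mono Tb Ta h; rewrite ab ltxx.
have uc : u = c.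
  rewrite /u -cy; apply: pinvKV; last by rewrite inE.
  by move=> a b; rewrite !inE; exact: inj.
rewrite uE uc; split => //.
move: cst; rewrite in_itv/= => /andP[sc ct].
have sc' : s < c.
  rewrite lt_neqAle sc andbT; apply/eqP => sc'.
  by move: cy; rewrite -sc' /y => h; lra.
have ct' : c < t.
  rewrite lt_neqAle ct andbT; apply/eqP => ct'.
  by move: cy; rewrite ct' /y => h; lra.
have : nbhs c `]s, t[%classic by apply: near_in_itvoo; rewrite in_itv/= sc'.
by apply: filterS => z /= /subset_itv_oo_cc /sub.
Qed.

End positive_derivative.

(** * The exponential family at an interior parameter *)

Section exponential_family.
Context d (X : measurableType d) (R : realType).
Variable nu : {sigma_finite_measure set X -> \bar R}.
Variables (Theta : set R) (eta A : R -> R) (T B : X -> R) (prior : R -> R).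
Hypothesis Theta_convex : convex_set (Theta : set R^o).
Hypothesis prior_continuous : {within Theta, continuous prior}.
Hypothesis prior_gt0 : forall theta, Theta theta -> 0 < prior theta.
Hypothesis prior_int1 :
  (\int[lebesgue_measure]_(theta in Theta) (prior theta)%:E = 1)%E.
Hypothesis eta_derivable : forall theta, Theta theta ->
  derivable_within Theta eta theta.
Hypothesis eta_derive_gt0 : forall theta, Theta theta ->
  0 < derive_within Theta eta theta.
Hypothesis density_measurable : forall theta, Theta theta ->
  measurable_fun setT (density eta A T B theta).
Hypothesis density_int1 : forall theta, Theta theta ->
  model nu eta A T B theta setT = 1%E.
Hypothesis T_nonconstant : forall theta, Theta theta ->
  ~ exists c : R, {ae model nu eta A T B theta, forall x, T x = c}.

Local Notation dens := (density eta A T B).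

Let mTheta : measurable Theta.
Proof. by apply: is_interval_measurable; exact: convex_set_is_interval. Qed.

Let dens_gt0 t x : 0 < dens t x. Proof. exact: expR_gt0. Qed.

Let dens_ge0 t x : 0 <= dens t x. Proof. exact: ltW. Qed.

Let eta_mono := eta_strict_mono Theta_convex eta_derivable eta_derive_gt0.

Let measurable_eta : measurable_fun Theta eta.
Proof.
apply: subspace_continuous_measurable_fun => //.
exact: (eta_continuous eta_derivable eta_derive_gt0).
Qed.

Let measurable_prior : measurable_fun Theta prior.
Proof. exact: subspace_continuous_measurable_fun. Qed.

Variable t0 : R.
Hypothesis Theta_t0 : Theta^° t0.

Let Tt0 : Theta t0. Proof. exact: interior_subset. Qed.

Let ball_Theta : exists2 de : R, 0 < de &
  forall t, `|t - t0| <= de -> Theta t.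
Proof.
have /nbhs_ballP[de /= de0 sub] := Theta_t0.
exists (de / 2); first by rewrite divr_gt0.
move=> t tde; apply: sub; rewrite -ball_normE/= distrC.
by apply: le_lt_trans tde _; rewrite ltr_pdivrMr// ltr_pMr// ltr1n.
Qed.

(** Two densities of the family determine [T] up to an affine map. *)
Let measurable_T : measurable_fun setT T.
Proof.
have [de de0 sub] := ball_Theta.
have T1 : Theta (t0 + de) by apply: sub; rewrite addrC addKr gtr0_norm.
have e1 : 0 < eta (t0 + de) - eta t0.
  by rewrite subr_gt0; apply: eta_mono => //; rewrite ltrDl.
have -> : T = fun x => (ln (dens (t0 + de) x) - ln (dens t0 x) +
    (A (eta (t0 + de)) - A (eta t0))) / (eta (t0 + de) - eta t0).
  by apply/funext => x; rewrite /density !expRK; field; rewrite gt_eqF.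
apply: measurable_funM => //; apply: measurable_funD => //.
apply: measurable_funB; apply: measurableT_comp => //.
  exact: density_measurable.
exact: density_measurable.
Qed.

Let a := derive_within Theta eta t0.

Let a0 : 0 < a. Proof. exact: eta_derive_gt0. Qed.

Definition natural_shift t := (eta t - eta t0) / a.

(** The centring [m] is left free: the mean of [T] is only known to exist once
    exponential moments have been extracted from [integral_density_tilt]. *)
Definition centred_score m x := a * (T x - m).

Definition centred_cumulant m t :=
  A (eta t) - A (eta t0) - (eta t - eta t0) * m.

Local Notation h := natural_shift.

Lemma density_tilt m t x :
  dens t x = dens t0 x * expR (h t * centred_score m x - centred_cumulant m t).
Proof.
rewrite /density -expRD; congr expR.
rewrite /natural_shift /centred_score /centred_cumulant; field.
by rewrite gt_eqF.
Qed.

Lemma integral_density_tilt m t : Theta t ->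
  (\int[nu]_x (dens t0 x * expR (h t * centred_score m x))%:E =
   (expR (centred_cumulant m t))%:E)%E.
Proof.
move=> Tt; rewrite -[RHS]mule1 -(density_int1 Tt) /model.
rewrite -ge0_integralZl_EFin; first last.
- exact: expR_ge0.
- by apply/measurable_EFinP; exact: density_measurable.
- by move=> x _; rewrite lee_fin.
- exact: measurableT.
apply: eq_integral => x _; rewrite -EFinM; congr (_%:E).
rewrite (density_tilt m t x); set u := h t * _; set k := centred_cumulant m t.
have -> : expR u = expR k * expR (u - k) by rewrite -expRD subrKC.
by ring.
Qed.

Let natural_shift_mono s t : Theta s -> Theta t -> s < t -> h s < h t.
Proof.
move=> Ts Tt st; rewrite ltr_pM2r ?invr_gt0// ltrD2r.
exact: eta_mono.
Qed.

Let natural_shift0 : h t0 = 0.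
Proof. by rewrite /natural_shift subrr mul0r. Qed.

Let centred_cumulant0 m : centred_cumulant m t0 = 0.
Proof. by rewrite /centred_cumulant !subrr mul0r subr0. Qed.

Let measurable_natural_shift : measurable_fun Theta h.
Proof. by apply: measurable_funM => //; exact: measurable_funB. Qed.

Let measurable_score m : measurable_fun setT (centred_score m).
Proof. by apply: measurable_funM => //; exact: measurable_funB. Qed.

Let natural_shift_near (e : R) : 0 < e -> exists2 de : R, 0 < de &
  forall t, `|t - t0| <= de -> Theta t /\ `|h t - (t - t0)| <= e * `|t - t0|.
Proof.
move=> e0; have [d1 d10 sub] := ball_Theta.
have [d2 d20 near_t] :=
  derive_within_near eta_derivable Tt0 (mulr_gt0 e0 a0).
exists (Num.min d1 d2); first by rewrite lt_min d10.
move=> t; rewrite le_min => /andP[td1 td2]; have Tt := sub t td1.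
split=> //; have := near_t t Tt td2; rewrite -/a.
have -> : h t - (t - t0) = (eta t - eta t0 - a * (t - t0)) / a.
  by rewrite /natural_shift; field; rewrite gt_eqF.
move=> ne; rewrite normrM normfV (gtr0_norm a0) ler_pdivrMr//.
by rewrite mulrAC.
Qed.

Definition score_mean := \int[nu]_x (dens t0 x * T x).

Local Notation Y := (centred_score score_mean).
Local Notation K := (centred_cumulant score_mean).

Let mdens : measurable_fun setT (dens t0).
Proof. exact: density_measurable. Qed.

Let score_moments m :=
  exponential_moment_exists (dens_ge0 t0) mdens (measurable_score m)
    natural_shift_mono natural_shift0 (centred_cumulant0 m)
    (@integral_density_tilt m) natural_shift_near.

Let integrable_score_moment m j : (j <= 3)%N ->
  nu.-integrable setT (EFin \o (fun x => dens t0 x * centred_score m x ^+ j)).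
Proof.
move=> j3; have [c c0 [iP iN]] := score_moments m.
exact: (integrable_moment (dens_ge0 t0) mdens (measurable_score m) c0 iP iN).
Qed.

Let integrable_dens : nu.-integrable setT (EFin \o dens t0).
Proof.
exact: (integrable_tilted_density (dens_ge0 t0) mdens natural_shift0
  (centred_cumulant0 0) (@integral_density_tilt 0) natural_shift_near).
Qed.

Let dens_int1 : \int[nu]_x dens t0 x = 1.
Proof. by have := density_int1 Tt0; rewrite /Rintegral /model => ->. Qed.

Let score_centred : \int[nu]_x (dens t0 x * Y x) = 0.
Proof.
have iT : nu.-integrable setT (EFin \o (fun x => dens t0 x * T x)).
  have := integrable_rZl a^-1 (integrable_score_moment 0 (isT : (1 <= 3)%N)).
  apply: eq_integrable => // x _ /=; congr (_%:E).
  by rewrite /centred_score subr0; field; rewrite gt_eqF.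
have -> : \int[nu]_x (dens t0 x * Y x) =
    \int[nu]_x (a * (dens t0 x * T x) + - (a * score_mean) * dens t0 x).
  by apply: eq_Rintegral => x _; rewrite /centred_score; ring.
rewrite RintegralD//; [|exact: integrable_rZl|exact: integrable_rZl].
by rewrite !RintegralZl// dens_int1 mulr1 -/score_mean subrr.
Qed.

Definition score_variance := \int[nu]_x (dens t0 x * Y x ^+ 2).

Let I := score_variance.

(** A vanishing variance would make [T] almost surely equal to its mean. *)
Let I_gt0 : 0 < I.
Proof.
have I_ge0 : 0 <= I.
  by apply: Rintegral_ge0 => x _; rewrite mulr_ge0// sqr_ge0.
rewrite lt_neqAle I_ge0 andbT; apply/negP => /eqP I0.
have i2 := integrable_score_moment score_mean (isT : (2 <= 3)%N).
have : (\int[nu]_x `|(dens t0 x * Y x ^+ 2)%:E| = 0)%E.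
  transitivity (\int[nu]_x (dens t0 x * Y x ^+ 2)%:E)%E.
    by apply: eq_integral => x _; rewrite gee0_abs// lee_fin mulr_ge0// sqr_ge0.
  rewrite integral_EFin_Rintegral//; congr (_%:E); exact: esym I0.
have mf : measurable_fun setT (fun x => (dens t0 x * Y x ^+ 2)%:E).
  exact: measurable_int i2.
move=> /(ae_eq_integral_abs nu measurableT mf).1 [N [mN N0 subN]].
apply: (T_nonconstant Tt0); exists score_mean; exists N; split => //.
  rewrite /model; apply: null_set_integral => //.
  by apply: measurable_funTS; apply/measurable_EFinP.
move=> x /= Tx; apply: subN => /= /(_ Logic.I) [] /eqP.
rewrite mulf_eq0 gt_eqF//= expf_eq0/= mulf_eq0 gt_eqF//= subr_eq0.
by move/eqP.
Qed.

Let K_near := cumulant_near (dens_ge0 t0) mdens (measurable_score score_mean)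
  natural_shift_mono natural_shift0 (centred_cumulant0 score_mean)
  (@integral_density_tilt score_mean) natural_shift_near score_centred I_gt0.

Let K_far := cumulant_far (dens_ge0 t0) mdens (measurable_score score_mean)
  natural_shift_mono natural_shift0 (centred_cumulant0 score_mean)
  (@integral_density_tilt score_mean) natural_shift_near score_centred I_gt0.

Let measurable_K : measurable_fun Theta K.
Proof.
exact: (measurable_cumulant (dens_ge0 t0) mdens
  (measurable_score score_mean) mTheta measurable_natural_shift
  (@integral_density_tilt score_mean)).
Qed.

Let within_interior : within Theta t0^' = t0^'.
Proof.
apply/funext => P; apply/propext; split.
  move=> wP; have T' : t0^' Theta by exact: nbhs_dnbhs Theta_t0.
  by apply: filterS (filterI T' wP) => u [Tu]; exact.
by apply: filterS => u Pu _.
Qed.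

(** The derivative of [A] is not available, but the quadratic bound on the
    centred cumulant function shows that its difference quotient at [t0] tends
    to 0; only the derivative of the term in [T x - score_mean] of the
    log-density remains. *)
Lemma score_eq x :
  derive_within Theta (fun t => ln (dens t x)) t0 = Y x.
Proof.
have PF : ProperFilter (within Theta t0^').
  by rewrite within_interior; exact: Proper_dnbhs_numFieldType.
apply: cvg_lim; first exact: Rhausdorff.
rewrite /diff_quotient_within within_interior.
have qE u : (ln (dens u x) - ln (dens t0 x)) / (u - t0) =
    (eta u - eta t0) / (u - t0) * (T x - score_mean) - K u / (u - t0).
  by rewrite /density !expRK /centred_cumulant; ring.
rewrite (eq_cvg _ _ qE).
have c1 : (eta u - eta t0) / (u - t0) * (T x - score_mean)
    @[u --> t0^'] --> a * (T x - score_mean).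
  apply: cvgM; last exact: cvg_cst.
  by have := eta_derivable Tt0; rewrite /derivable_within
    /a /derive_within /diff_quotient_within within_interior.
suff c2 : K u / (u - t0) @[u --> t0^'] --> 0.
  have := cvgB c1 c2; rewrite subr0; exact.
apply/cvgrPdist_le => e e0.
have [de de0 Kn] := K_near ltr01.
pose M := I / 2 + 1; have M0 : 0 < M by rewrite addr_gt0// divr_gt0.
apply/nbhs_ballP; exists (Num.min de (e / M)) => /=.
  by rewrite lt_min de0 divr_gt0.
move=> u; rewrite -ball_normE/= lt_min distrC => /andP[ude uM] ut.
have u0 : 0 < `|u - t0| by rewrite normr_gt0 subr_eq0.
rewrite sub0r normrN normrM normfV ler_pdivrMr//.
have KM : `|K u| <= M * `|u - t0| ^+ 2.
  rewrite -[K u](subrK (I / 2 * (u - t0) ^+ 2)).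
  apply: (le_trans (ler_normD _ _)).
  apply: (le_trans (lerD (Kn u (ltW ude)) (lexx _))).
  have Iu0 : 0 <= I / 2 * (u - t0) ^+ 2.
    by apply: mulr_ge0; [apply: divr_ge0 => //; exact: ltW|exact: sqr_ge0].
  rewrite (ger0_norm Iu0).
  by rewrite real_normK ?num_real// /M; lra.
apply: (le_trans KM); rewrite expr2 mulrA ler_pM2r//.
by rewrite mulrC -ler_pdivlMr// ltW.
Qed.

Lemma fisher_info_eq : fisher_info nu Theta eta A T B t0 = I.
Proof. by apply: eq_Rintegral => x _; rewrite score_eq mulrC. Qed.

Lemma fisher_info_gt0 : 0 < fisher_info nu Theta eta A T B t0.
Proof. by rewrite fisher_info_eq. Qed.

Let posterior_local (e : R) : 0 < e -> exists2 de : R, 0 < de &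
  forall t, `|t - t0| <= de -> [/\ Theta t,
    `|h t - (t - t0)| <= e * `|t - t0|,
    `|K t - I / 2 * (t - t0) ^+ 2| <= e * (t - t0) ^+ 2 &
    `|prior t - prior t0| <= e * prior t0].
Proof.
move=> e0; have [d1 d10 hn] := natural_shift_near e0.
have [d2 d20 Kn] := K_near e0.
have ep0 : 0 < e * prior t0 by rewrite mulr_gt0// prior_gt0.
have /subspace_continuousP/(_ t0 Tt0)/cvgrPdist_le/(_ _ ep0) :=
  prior_continuous.
move=> /nbhs_ballP[d3 /= d30 pn].
exists (Num.min d1 (Num.min d2 (d3 / 2))).
  by rewrite !lt_min d10 d20 divr_gt0.
move=> t; rewrite !le_min => /and3P[td1 td2 td3].
have [Tt ht] := hn t td1; split => //; first exact: Kn.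
rewrite distrC; apply: pn => //; rewrite -ball_normE/= distrC.
by apply: le_lt_trans td3 _; rewrite ltr_pdivrMr// ltr_pMr// ltr1n.
Qed.

Lemma likelihood_tilt t n (s : n.-tuple X) :
  likelihood eta A T B t s = likelihood eta A T B t0 s *
    expR (h t * sample_sum Y s - n%:R * K t).
Proof.
rewrite /likelihood /sample_sum mulr_sumr -[n in n%:R * _]card_ord.
rewrite mulr_natl -sumr_const -sumrB expR_sum -big_split/=.
by apply: eq_bigr => i _; exact: density_tilt.
Qed.

Lemma evidence_tilt n (s : n.-tuple X) :
  (evidence Theta eta A T B prior s =
   (likelihood eta A T B t0 s)%:E *
   tilted_mass Theta h K prior n (sample_sum Y s))%E.
Proof.
rewrite /evidence /tilted_mass -ge0_integralZl_EFin//.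
- by apply: eq_integral => t _; rewrite likelihood_tilt -mulrA EFinM.
- by move=> t Tt; rewrite lee_fin mulr_ge0 ?expR_ge0// ltW// prior_gt0.
- exact: measurable_tilted_integrand.
- by apply: prodr_ge0 => i _; exact: dens_ge0.
Qed.

Let mass_gt0 := tilted_mass_gt0 mTheta measurable_natural_shift measurable_K
  measurable_prior prior_gt0 prior_int1.

(** The likelihood at [t0] cancels, which leaves a function of the sum of the
    centred scores alone.  An infinite evidence is an infinite tilted mass, and
    both quotients are then 0. *)
Lemma posterior_tilt n (s : n.-tuple X) :
  (posterior Theta eta A T B prior t0 s =
   (prior t0)%:E / tilted_mass Theta h K prior n (sample_sum Y s))%E.
Proof.
rewrite /posterior evidence_tilt.
have L0 : 0 < likelihood eta A T B t0 s.
  by apply: prodr_gt0 => i _; exact: dens_gt0.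
have := mass_gt0 n (sample_sum Y s); case: tilted_mass => [r|_|//].
  rewrite lte_fin => r0; rewrite -EFinM !inver !gt_eqF ?mulr_gt0// -!EFinM.
  by congr (_%:E); field; rewrite !gt_eqF.
by rewrite gt0_muley ?lte_fin// invey !mule0.
Qed.

Lemma measurable_posterior n :
  measurable_fun [set: n.-tuple X]
    (@posterior R d X Theta eta A T B prior t0 n).
Proof.
rewrite (funext (@posterior_tilt n)).
apply: (measurableT_comp (measurable_div_tilted_mass mTheta
  measurable_natural_shift measurable_K measurable_prior prior_gt0 prior_int1
  _ _)).
exact: measurable_sample_sum.
Qed.

Lemma expected_posterior_near (e : R) : 0 < e -> \forall n \near \oo,
  let c := Num.sqrt (fisher_info nu Theta eta A T B t0) / (2 * Num.sqrt pi) in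
  (((c - e) * Num.sqrt n%:R)%:E <=
   expected_posterior nu Theta eta A T B prior t0 t0 n <=
   ((c + e) * Num.sqrt n%:R)%:E)%E.
Proof.
move=> e0; have [c c0 [iP iN]] := score_moments score_mean.
have i1 := integrable_score_moment score_mean (isT : (1 <= 3)%N).
have i3 := integrable_norm_moment (dens_ge0 t0) mdens
  (measurable_score score_mean) c0 iP iN (isT : (3 <= 3)%N).
have main := expected_posterior_estimate mTheta measurable_natural_shift
  measurable_K measurable_prior prior_gt0 prior_int1 I_gt0 Tt0 posterior_local
  K_far (dens_ge0 t0) mdens (measurable_score score_mean) (density_int1 Tt0)
  i1 (integrable_score_moment score_mean (isT : (2 <= 3)%N)) i3 score_centred
  (erefl _) e0.
have E n : expected_posterior nu Theta eta A T B prior t0 t0 n =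
    (\int[power_measure nu n]_s ((prior t0)%:E /
       tilted_mass Theta h K prior n (sample_sum Y s) *
       (sample_density (dens t0) s)%:E))%E.
  rewrite /expected_posterior; have [m ->] := power_measure_sigma_finite nu n.
  by apply: eq_integral => s _; rewrite posterior_tilt.
by apply: filterS main => n; rewrite fisher_info_eq E.
Qed.

Lemma measurable_likelihood n :
  measurable_fun [set: n.-tuple X] (@likelihood R d X eta A T B t0 n).
Proof. exact: measurable_sample_density. Qed.

End exponential_family.

(** * Midpoints of natural parameters *)

Section change_of_parameter.
Context d (X : measurableType d) (R : realType).
Variable nu : {sigma_finite_measure set X -> \bar R}.
Variables (Theta : set R) (eta A : R -> R) (T B : X -> R) (prior : R -> R).
Variables t0 t1 t2 : R.
Hypothesis eta2 : eta t2 = (eta t0 + eta t1) / 2.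

Local Notation dens := (density eta A T B).

(** The logarithm of the squared Hellinger affinity of the densities at [t0]
    and [t1]. *)
Definition log_affinity : R := 2 * A (eta t2) - A (eta t0) - A (eta t1).

Let w := expR log_affinity.

(** The exponent is affine in the natural parameter apart from the
    cumulant function, so that the geometric mean of two densities is, up to a
    constant, the density at the midpoint of the natural parameters. *)
Lemma density_midpoint x : dens t0 x * dens t1 x = dens t2 x ^+ 2 * w.
Proof.
rewrite /w /density expr2 -!expRD; congr expR; rewrite /log_affinity eta2.
by field.
Qed.

Lemma likelihood_midpoint n (s : n.-tuple X) :
  likelihood eta A T B t0 s * likelihood eta A T B t1 s =
  likelihood eta A T B t2 s ^+ 2 * w ^+ n.
Proof.
have -> : w ^+ n = \prod_(i < n) w by rewrite prodr_const card_ord.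
rewrite /likelihood -big_split/= -prodrXl.
by rewrite -big_split/=; apply: eq_bigr => i _; exact: density_midpoint.
Qed.

Lemma affinity_midpoint : measurable_fun setT (dens t2) ->
  model nu eta A T B t2 setT = 1%E ->
  affinity nu eta A T B t0 t1 = w.
Proof.
move=> mdens d1; rewrite /affinity.
have wE : w = expR (log_affinity / 2) ^+ 2.
  by rewrite /w [in LHS](splitr log_affinity) expRD expr2.
rewrite [RHS]wE; congr (_ ^+ 2); rewrite /Rintegral.
have -> : (\int[nu]_x (Num.sqrt (dens t0 x * dens t1 x))%:E =
    \int[nu]_x ((dens t2 x)%:E * (expR (log_affinity / 2))%:E))%E.
  apply: eq_integral => x _.
  rewrite density_midpoint wE -exprMn sqrtr_sqr -EFinM.
  by rewrite ger0_norm// mulr_ge0 ?expR_ge0.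
rewrite ge0_integralZr; first last.
- by rewrite lee_fin expR_ge0.
- by move=> x _; rewrite lee_fin expR_ge0.
- exact/measurable_EFinP.
- exact: measurableT.
by move: d1; rewrite /model => ->; rewrite mul1e.
Qed.

(** The evidence is the same on both sides, so that the identity of likelihoods
    gives an identity of integrands. *)
Lemma expected_posterior_midpoint n :
  measurable_fun setT (fun s : n.-tuple X =>
    posterior Theta eta A T B prior t2 s * (likelihood eta A T B t2 s)%:E)%E ->
  (forall t, Theta t -> 0 < prior t) -> Theta t0 -> Theta t2 ->
  (expected_posterior nu Theta eta A T B prior t1 t0 n =
   (prior t0 / prior t2)%:E *
   expected_posterior nu Theta eta A T B prior t2 t2 n * (w ^+ n)%:E)%E.
Proof.
move=> mpost prior_gt0 T0 T2.
have p0 := prior_gt0 _ T0; have p2 := prior_gt0 _ T2.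
have L0 t (s : n.-tuple X) : 0 <= likelihood eta A T B t s.
  by apply: prodr_ge0 => i _; exact: expR_ge0.
have ev0 (s : n.-tuple X) : (0 <= evidence Theta eta A T B prior s)%E.
  by apply: integral_ge0 => t Tt; rewrite lee_fin mulr_ge0// ltW// prior_gt0.
rewrite /expected_posterior; have [m ->] := power_measure_sigma_finite nu n.
rewrite muleAC -EFinM -ge0_integralZl_EFin//.
- apply: eq_integral => s _; rewrite /posterior.
  rewrite muleAC -EFinM [in RHS]muleAC muleA -!EFinM; congr (_%:E * _)%E.
  rewrite [LHS](_ : _ = prior t0 * (likelihood eta A T B t0 s *
    likelihood eta A T B t1 s)); last by ring.
  by rewrite likelihood_midpoint; field; rewrite gt_eqF.
- move=> s _; rewrite mule_ge0 ?lee_fin// mule_ge0 ?inve_ge0//.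
  by rewrite lee_fin mulr_ge0// ltW.
- by rewrite mulr_ge0 ?exprn_ge0 ?expR_ge0// divr_ge0// ltW.
Qed.

End change_of_parameter.

(** * Asymptotics of the expected posterior density *)

(** An additive error [e * c * sqrt n] is a relative error [e], and finiteness
    of [f n] is part of the two bounds. *)
Lemma asymptotic_of_near (R : realType) (f : nat -> \bar R) (c : R) : 0 < c ->
  (forall e : R, 0 < e -> \forall n \near \oo,
    (((c - e) * Num.sqrt n%:R)%:E <= f n <= ((c + e) * Num.sqrt n%:R)%:E)%E) ->
  asymptotic f (fun n => (c * Num.sqrt n%:R)%:E).
Proof.
move=> c0 fc.
have near_ratio (e : R) : 0 < e -> \forall n \near \oo,
    exists2 r : R, (f n / (c * Num.sqrt n%:R)%:E)%E = r%:E & `|1 - r| <= e.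
  move=> e0; near=> n.
  have n0 : (0 < n)%N by near: n; exact: nbhs_infty_gt.
  have q0 : 0 < Num.sqrt n%:R :> R by rewrite sqrtr_gt0 ltr0n.
  have : (((c - e * c) * Num.sqrt n%:R)%:E <= f n <=
      ((c + e * c) * Num.sqrt n%:R)%:E)%E.
    by near: n; apply: fc; rewrite mulr_gt0.
  have cq : 0 < c * Num.sqrt n%:R by rewrite mulr_gt0.
  case: (f n) => [r| |]; rewrite ?leye_eq ?leeNy_eq//= ?andbF//.
  rewrite !lee_fin => /andP[lo hi]; exists (r / (c * Num.sqrt n%:R)).
    by rewrite inver gt_eqF.
  rewrite ler_distlC ler_pdivlMr// ler_pdivrMr//.
  by apply/andP; split; [apply: le_trans lo|apply: (le_trans hi)];
    rewrite le_eqVlt; apply/orP; left; apply/eqP; ring.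
apply/fine_cvgP; split.
  by apply: filterS (near_ratio 1 ltr01) => n [r -> _].
apply/cvgrPdist_le => e e0.
by apply: filterS (near_ratio e e0) => n [r /= -> /=].
Unshelve. all: by end_near.
Qed.

Theorem theorem1 (R : realType) (X : set R) (x0 : X)
    (nu : {sigma_finite_measure set (borel_sub x0) -> \bar R})
    (Theta : set R) (eta A : R -> R) (T B : borel_sub x0 -> R)
    (prior : R -> R)
    (Theta_convex : convex_set (Theta : set R^o))
    (prior_continuous : {within Theta, continuous prior})
    (prior_gt0 : forall theta, Theta theta -> 0 < prior theta)
    (prior_int1 :
      (\int[lebesgue_measure]_(theta in Theta) (prior theta)%:E = 1)%E)
    (eta_derivable : forall theta, Theta theta ->
      derivable_within Theta eta theta)
    (eta_derive_gt0 : forall theta, Theta theta ->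
      0 < derive_within Theta eta theta)
    (density_measurable : forall theta, Theta theta ->
      measurable_fun setT (density eta A T B theta))
    (density_int1 : forall theta, Theta theta ->
      model nu eta A T B theta setT = 1%E)
    (T_nonconstant : forall theta, Theta theta ->
      ~ exists c : R, {ae model nu eta A T B theta, forall x, T x = c}) :
  let q := expected_posterior nu Theta eta A T B prior in
  let I := fisher_info nu Theta eta A T B in
  (forall theta0 : R, interior Theta theta0 ->
     asymptotic (q theta0 theta0)
       (fun n => (Num.sqrt (I theta0) / (2 * Num.sqrt pi)
                    * Num.sqrt n%:R)%:E))
  /\
  (forall theta0 theta1 : R, Theta theta0 -> Theta theta1 ->
     theta1 <> theta0 ->
     let theta2 := pinv Theta eta ((eta theta0 + eta theta1) / 2) in
     let w := affinity nu eta A T B theta0 theta1 in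
     [/\ Theta theta2,
         eta theta2 = (eta theta0 + eta theta1) / 2,
         (forall n : nat, (0 < n)%N ->
            (q theta1 theta0 n =
             (prior theta0 / prior theta2)%:E * q theta2 theta2 n
               * (w ^+ n)%:E)%E)
       & asymptotic (q theta1 theta0)
           (fun n => (prior theta0 / prior theta2
                        * (Num.sqrt (I theta2) / (2 * Num.sqrt pi))
                        * Num.sqrt n%:R * w ^+ n)%:E)]).
Proof.
move=> q I.
have near_interior t : Theta^° t -> 0 < I t /\ asymptotic (q t t)
    (fun n => (Num.sqrt (I t) / (2 * Num.sqrt pi) * Num.sqrt n%:R)%:E).
  move=> Tt; have I0 : 0 < I t.
    exact: (fisher_info_gt0 Theta_convex eta_derivable eta_derive_gt0
      density_measurable density_int1 T_nonconstant Tt).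
  split=> //; apply: asymptotic_of_near.
    by rewrite divr_gt0 ?sqrtr_gt0// mulr_gt0// sqrtr_gt0 pi_gt0.
  move=> e e0; exact: (expected_posterior_near Theta_convex prior_continuous
    prior_gt0 prior_int1 eta_derivable eta_derive_gt0 density_measurable
    density_int1 T_nonconstant Tt e0).
split=> [t /near_interior[]//|t0 t1 T0 T1 t10 t2 w].
have [T2 eta2 int2] := eta_midpoint Theta_convex eta_derivable eta_derive_gt0
  T0 T1 t10.
rewrite -/t2 in T2 eta2 int2.
have wE : w = expR (log_affinity eta A t0 t1 t2).
  apply: affinity_midpoint => //; first exact: density_measurable.
  exact: density_int1.
have exact_eq n : (q t1 t0 n =
    (prior t0 / prior t2)%:E * q t2 t2 n * (w ^+ n)%:E)%E.
  rewrite wE; apply: expected_posterior_midpoint => //.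
  apply: emeasurable_funM.
    exact: (measurable_posterior Theta_convex prior_continuous prior_gt0
      prior_int1 eta_derivable eta_derive_gt0 density_measurable density_int1
      int2).
  apply/measurable_EFinP.
  exact: (measurable_likelihood density_measurable int2).
split => //.
have [I0 asym2] := near_interior t2 int2.
set c := Num.sqrt (I t2) / (2 * Num.sqrt pi) in asym2 *.
have c0 : 0 < c by rewrite divr_gt0 ?sqrtr_gt0// mulr_gt0// sqrtr_gt0 pi_gt0.
have k0 : 0 < prior t0 / prior t2 by rewrite divr_gt0// prior_gt0.
apply: cvg_trans asym2; apply: near_eq_cvg; near=> n.
have n0 : (0 < n)%N by near: n; exact: nbhs_infty_gt.
have q0 : 0 < Num.sqrt n%:R :> R by rewrite sqrtr_gt0 ltr0n.
have w0 : 0 < w ^+ n by rewrite wE exprn_gt0 ?expR_gt0.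
have assoc (k W V : R) (Q : \bar R) :
    (k%:E * Q * W%:E * V%:E = Q * (k * (W * V))%:E)%E.
  by rewrite [(k%:E * Q)%E]muleC -!muleA -!EFinM.
have cq0 : 0 < c * Num.sqrt n%:R by rewrite mulr_gt0.
have kq0 : 0 < prior t0 / prior t2 * c * Num.sqrt n%:R * w ^+ n.
  by do 3 apply: mulr_gt0 => //.
rewrite exact_eq !inver (gt_eqF cq0) (gt_eqF kq0) assoc.
move: (prior t0 / prior t2) k0 (Num.sqrt n%:R) q0 (w ^+ n) w0 {cq0 kq0 assoc}.
move=> k k0 r r0 v v0; congr (_ * _%:E)%E.
by field; rewrite !gt_eqF.
Unshelve. all: by end_near.
Qed.
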